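(* Let $K$ be a polynomial decay kernel of order $m$, i.e. $\mu_i\asymp i^{-2m}$. Suppose that the step sizes $\{\alpha_t\}_{t\ge0}$ are non-increasing with $0\le\alpha_\tau\le\min\{1,1/\widehat\mu_1\}$ for all $\tau\ge0$, that $\eta_t\to\infty$ as $t\to\infty$, that for $0\le t_1\ll t_2$ as $t_2\to\infty$, $\eta_{t_1}\ll\eta_{t_2}$, and that $m>3/2$. Then at time $T^*$ with $\eta_{T^*}\asymp n^{4m/(4m+1)}$, for any $\varepsilon>0$ there exist constants $C_\varepsilon$ and $N_\varepsilon$ such that, with probability greater than $1-e^{-c_mn^{(2m-3)/(2m-1)}}-e^{-c_1n^{2/(4m+1)}}$, $$\inf_{n\ge N_\varepsilon}\ \inf_{\substack{f\in\mathcal{B}\\ \|f\|_n\ge C_\varepsilon n^{-\frac{2m}{4m+1}}}}P_f(\phi_{n,T^*}=1\mid\boldsymbol{x})\ \ge\ 1-\varepsilon,$$ where $c_m$ is an absolute constant depending on $m$ only and $c_1$ is a constant.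
   Context: Model: $y_i=f(x_i)+\epsilon_i$, $i=1,\dots,n$, where $x_i\in\mathcal{X}\subset\mathbb{R}^d$ ($d\ge1$ fixed) are i.i.d. random covariates with distribution $P_X$, and the $\epsilon_i$ are i.i.d. Gaussian noise, independent of the covariates, with mean zero and variance $\sigma^2=1$. Write $\boldsymbol{x}=(x_1,\dots,x_n)$, $\boldsymbol{y}=(y_1,\dots,y_n)^\top$. The function $f$ lies in a reproducing kernel Hilbert space $\mathcal{H}\subset L^2(P_X)$ with reproducing kernel $K$ having Mercer expansion $K(x,x')=\sum_{i\ge1}\mu_i\phi_i(x)\phi_i(x')$, $\mu_1\ge\mu_2\ge\cdots\ge0$, with $\langle\phi_i,\phi_j\rangle_{L^2(P_X)}=\delta_{ij}$ and $\langle\phi_i,\phi_j\rangle_{\mathcal{H}}=\delta_{ij}/\mu_i$. Assumed throughout: there is a finite constant $c_K>0$ with $\sup_{j}\|\phi_j\|_{\sup}\le c_K$. Empirical norm: $\|f\|_n^2=\frac1n\sum_{i=1}^nf(x_i)^2$. $\mathcal{B}=\{f\in\mathcal{H}:\|f\|_{\mathcal{H}}\le C\}$ for a constant $C$. $P_f$ is the probability measure under $f$. Empirical kernel matrix: $[\boldsymbol{K}]_{ij}=\frac1nK(x_i,x_j)$, $\boldsymbol{K}=U\Lambda U^\top$, $UU^\top=I_n$, $\Lambda=\operatorname{diag}(\widehat\mu_1,\dots,\widehat\mu_n)$, $\widehat\mu_1\ge\cdots\ge\widehat\mu_n\ge0$. Gradient descent: with step sizes $\{\alpha_t\}_{t\ge0}$,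 $\boldsymbol{f}_{t}=(f_t(x_1),\dots,f_t(x_n))^\top$ satisfies $\boldsymbol{f}_{t+1}=\boldsymbol{f}_t-\alpha_t\boldsymbol{K}(\boldsymbol{f}_t-\boldsymbol{y})$, with $\boldsymbol{f}_0=0$. Total step size: $\eta_t=\sum_{\tau=0}^{t-1}\alpha_\tau$. Shrinkage matrices: $S^t=\prod_{\tau=0}^{t-1}(I_n-\alpha_\tau\Lambda)$. Here $a\ll b$ means $a/b\to0$, and $a\asymp b$ means equality up to positive multiplicative constants. Testing $H_0:f=0$ against $H_1:f\in\mathcal{H}\setminus\{0\}$: $D_{n,t}=\|f_t\|_n^2$; $\mu_{n,t}=\frac1n\operatorname{tr}((I_n-S^t)^2)$, $\sigma_{n,t}^2=\frac2{n^2}\operatorname{tr}((I_n-S^t)^4)$; the test at significance level $\alpha$ is $\phi_{n,t}=I(|D_{n,t}-\mu_{n,t}|\ge z_{1-\alpha/2}\sigma_{n,t})$, with $z_{1-\alpha/2}$ the $100(1-\alpha/2)$th percentile of the standard normal distribution. Stopping rule: $$T^*=\min\Big\{t\in\mathbb{N}:\ \frac1{\eta_t}<\frac{\sigma}{n}\sqrt{\textstyle\sum_{i=1}^n\min\{1,\eta_t\widehat\mu_i\}}\Big\}.$$ The phrase ''with probability'' refers to the randomness of $\boldsymbol{x}$. *)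

(* Defs.v *)
From HB Require Import structures.
From mathcomp Require Import all_boot all_order all_algebra.
From mathcomp Require Import all_classical all_reals all_analysis.

Set Implicit Arguments.
Unset Strict Implicit.
Unset Printing Implicit Defensive.

Import Order.TTheory GRing.Theory Num.Theory.
Import numFieldNormedType.Exports.

Local Open Scope classical_set_scope.
Local Open Scope ring_scope.

(* Functions on a domain D of a type T are represented by functions T -> R
   vanishing outside D (extension by zero), so that extensional equality on D
   is equality.  H is the set of functions and ip its inner product, whose
   values outside H are irrelevant. *)
Record is_rkhs (R : realType) (T : Type) (D : set T) (H : set (T -> R))
    (ip : (T -> R) -> (T -> R) -> R) (K : T -> T -> R) : Prop := IsRKHS {
  rkhs_supp : forall f, H f -> forall x, ~ D x -> f x = 0 ;
  rkhs_zero : H (fun=> 0) ;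
  rkhs_lin : forall (a : R) f g, H f -> H g -> H (fun x => a * f x + g x) ;
  rkhs_ipC : forall f g, H f -> H g -> ip f g = ip g f ;
  rkhs_ip_lin : forall (a : R) f g h, H f -> H g -> H h ->
    ip (fun x => a * f x + g x) h = a * ip f h + ip g h ;
  rkhs_ip_ge0 : forall f, H f -> 0 <= ip f f ;
  rkhs_ip_eq0 : forall f, H f -> ip f f = 0 -> f = (fun=> 0) ;
  rkhs_complete : forall u : nat -> T -> R, (forall k, H (u k)) ->
    (forall e, 0 < e -> exists N, forall j k, (N <= j)%N -> (N <= k)%N ->
      ip (fun x => u j x - u k x) (fun x => u j x - u k x) < e) ->
    exists2 f, H f &
      ip (fun x => u k x - f x) (fun x => u k x - f x) @[k --> \oo] --> 0 ;
  rkhs_kernel : forall x, H (fun y => K y x) ;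
  rkhs_reproducing : forall f x, H f -> f x = ip f (fun y => K y x) }.

Definition sub_L2 (R : realType) (dT : measure_display) (T : measurableType dT)
    (PX : probability T R) (H : set (T -> R)) : Prop :=
  forall f, H f -> measurable_fun [set: T] f /\
    PX.-integrable [set: T] (fun x => (f x ^+ 2)%:E).

(* mu i and phi i are the (i+1)-st eigenvalue and eigenfunction. *)
Record mercer (R : realType) (dT : measure_display) (T : measurableType dT)
    (PX : probability T R) (H : set (T -> R))
    (ip : (T -> R) -> (T -> R) -> R) (K : T -> T -> R)
    (mu : nat -> R) (phi : nat -> T -> R) : Prop := Mercer {
  mercer_decr : forall i, mu i.+1 <= mu i ;
  mercer_ge0 : forall i, 0 <= mu i ;
  mercer_expansion : forall x x',
    series (fun i => mu i * phi i x * phi i x') k @[k --> \oo] --> K x x' ;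
  mercer_in : forall i, H (phi i) ;
  mercer_L2 : forall i j,
    (\int[PX]_x (phi i x * phi j x)%:E = (i == j)%:R%:E)%E ;
  mercer_H : forall i j, ip (phi i) (phi j) = (i == j)%:R / mu i }.

Definition poly_decay (R : realType) (m : R) (mu : nat -> R) : Prop :=
  exists a b : R, [/\ 0 < a, 0 < b & forall i : nat,
    a * i.+1%:R `^ (- (2 * m)) <= mu i <= b * i.+1%:R `^ (- (2 * m))].

Section sampling.
Context (R : realType) (dO : measure_display) (Omega : measurableType dO)
  (P : probability Omega R).

Definition mutually_independent (dT : measure_display) (T : measurableType dT)
    (X : nat -> Omega -> T) : Prop :=
  forall (J : seq nat) (A : nat -> set T), uniq J ->
    (forall i, measurable (A i)) ->
    (P (\bigcap_(i in [set` J]) (X i @^-1` A i))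
     = \prod_(i <- J) P (X i @^-1` A i))%E.

Definition iid (dT : measure_display) (T : measurableType dT)
    (X : nat -> Omega -> T) (Q : set T -> \bar R) : Prop :=
  mutually_independent X /\
  forall i A, measurable A -> P (X i @^-1` A) = Q A.

Definition sample (T : Type) (X : nat -> Omega -> T) (n : nat) (w : Omega)
    : n.-tuple T := [tuple X i w | i < n].

Definition independent_vectors (d1 d2 : measure_display)
    (T1 : measurableType d1) (T2 : measurableType d2)
    (V : Omega -> T1) (W : Omega -> T2) : Prop :=
  forall A B, measurable A -> measurable B ->
    (P ((V @^-1` A) `&` (W @^-1` B)) = P (V @^-1` A) * P (W @^-1` B))%E.

(* kappa is a regular conditional distribution of W given V. *)
Definition cond_distribution (d1 d2 : measure_display)
    (T1 : measurableType d1) (T2 : measurableType d2)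
    (V : Omega -> T1) (W : Omega -> T2) (kappa : R.-pker T1 ~> T2) : Prop :=
  forall A B, measurable A -> measurable B ->
    (P ((V @^-1` A) `&` (W @^-1` B))
     = \int[P]_(w in V @^-1` A) kappa (V w) B)%E.

End sampling.

Section gradient_descent_test.
Context (R : realType).

Definition emp_norm (n : nat) (v : 'cV[R]_n) : R :=
  Num.sqrt (n%:R^-1 * \sum_i v i 0 ^+ 2).

Definition eval_at (T : Type) (n : nat) (f : T -> R) (x : n.-tuple T)
    : 'cV[R]_n := \col_i f (tnth x i).

Definition kernel_mx (T : Type) (n : nat) (K : T -> T -> R) (x : n.-tuple T)
    : 'M[R]_n := \matrix_(i, j) (n%:R^-1 * K (tnth x i) (tnth x j)).

(* lam i is the (i+1)-st largest eigenvalue; its values for i >= n are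
   irrelevant. *)
Definition lam_mx (n : nat) (lam : nat -> R) : 'M[R]_n :=
  diag_mx (\row_i lam (val i)).

Record eigendecomposition (n : nat) (K U : 'M[R]_n) (lam : nat -> R) : Prop :=
  Eigendecomposition {
  eigen_orth : U *m U^T = 1%:M ;
  eigen_eq : K = U *m lam_mx n lam *m U^T ;
  eigen_decr : forall i j, (i <= j)%N -> (j < n)%N -> lam j <= lam i ;
  eigen_ge0 : forall i, (i < n)%N -> 0 <= lam i }.

Fixpoint grad_descent (n : nat) (alpha : nat -> R) (K : 'M[R]_n) (y : 'cV[R]_n)
    (t : nat) : 'cV[R]_n :=
  if t is t'.+1 then
    let ft := grad_descent alpha K y t' in
    ft - alpha t' *: (K *m (ft - y))
  else 0.

Definition total_step (alpha : nat -> R) (t : nat) : R :=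
  \sum_(0 <= tau < t) alpha tau.

(* The inverse is the extended-real one: 1 / 0 = +oo. *)
Record step_sizes (alpha : nat -> R) (lam1 : R) : Prop := StepSizes {
  step_noninc : forall t, alpha t.+1 <= alpha t ;
  step_ge0 : forall t, 0 <= alpha t ;
  step_le : forall t, ((alpha t)%:E <= mine 1 (lam1%:E)^-1)%E ;
  step_total : total_step alpha t @[t --> \oo] --> +oo ;
  step_growth : forall t1 t2 : nat -> nat,
    t2 k @[k --> \oo] --> \oo ->
    (t1 k)%:R / (t2 k)%:R @[k --> \oo] --> (0 : R) ->
    total_step alpha (t1 k) / total_step alpha (t2 k) @[k --> \oo] --> 0 }.

Definition shrinkage (n : nat) (alpha lam : nat -> R) (t : nat) : 'M[R]_n :=
  \prod_(0 <= tau < t) (1%:M - alpha tau *: lam_mx n lam).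

Definition null_mean (n : nat) (alpha lam : nat -> R) (t : nat) : R :=
  n%:R^-1 * \tr ((1%:M - shrinkage n alpha lam t) ^+ 2).

Definition null_sd (n : nat) (alpha lam : nat -> R) (t : nat) : R :=
  Num.sqrt (2 / n%:R ^+ 2 * \tr ((1%:M - shrinkage n alpha lam t) ^+ 4)).

Definition test_stat (n : nat) (alpha : nat -> R) (K : 'M[R]_n) (y : 'cV[R]_n)
    (t : nat) : R := emp_norm (grad_descent alpha K y t) ^+ 2.

Definition test (n : nat) (alpha lam : nat -> R) (K : 'M[R]_n) (z : R)
    (t : nat) (y : 'cV[R]_n) : bool :=
  z * null_sd n alpha lam t
    <= `|test_stat alpha K y t - null_mean n alpha lam t|.

(* The inverse is the extended-real one, so that the criterion fails as long
   as total_step alpha t = 0. *)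
Definition stop_criterion (n : nat) (sigma : R) (alpha lam : nat -> R)
    (t : nat) : Prop :=
  (((total_step alpha t)%:E)^-1 <
    (sigma / n%:R *
       Num.sqrt (\sum_(i < n) Num.min 1 (total_step alpha t * lam i)))%:E)%E.

Definition is_stopping_time (n : nat) (sigma : R) (alpha lam : nat -> R)
    (t : nat) : Prop :=
  stop_criterion n sigma alpha lam t /\
  forall t', stop_criterion n sigma alpha lam t' -> (t <= t')%N.

(* P_f (test = 1 | x): the observations are y = f(x) + noise and kappa is the
   conditional distribution of the noise given the covariates. *)
Definition cond_power (dT : measure_display) (T : measurableType dT) (n : nat)
    (kappa : R.-pker (n.-tuple T) ~> (n.-tuple R)) (phi : 'cV[R]_n -> bool)
    (f : T -> R) (x : n.-tuple T) : \bar R :=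
  kappa x [set e | phi (eval_at f x + \col_i tnth e i)].

End gradient_descent_test.

(* Main.v *)
Require Import Defs.
From HB Require Import structures.
From mathcomp Require Import all_boot all_order all_algebra.
From mathcomp Require Import all_classical all_reals all_analysis.
From mathcomp Require Import measurable_realfun.
From mathcomp Require Import ring lra.

Import Order.TTheory GRing.Theory Num.Theory.
Import numFieldNormedType.Exports.

Set Implicit Arguments.
Unset Strict Implicit.
Unset Printing Implicit Defensive.

Local Open Scope classical_set_scope.
Local Open Scope ring_scope.

(** Fix the design and write v for the vector of values of f and e for the
    noise.  In the eigenbasis of the kernel matrix, gradient descent multiplies
    the i-th coordinate of v + e by g_i = 1 - S_i, hence, with G the matrix of
    eigenvalues g_i,
      n (D - mu_{n,t}) = |G v|^2 + Z,
    where Z is a centered quadratic form plus a linear form in e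
    ([test_stat_noise]).  Its second moment is at most a constant times
    tr G^4 + |G v|^2 ([quadratic_chebyshev]), so Chebyshev's inequality bounds
    the type II error as soon as |G v|^2 dominates sqrt (tr G^4)
    ([type_two_error]).

    Two inequalities hold for every design.  First tr G^4 <= N(eta), where
    N(eta) = sum_i min(1, eta lam_i) is the effective dimension
    ([filter_pow4_le]).  Secondly |(1 - G) v|^2 <= n C^2 / eta on the ball of
    radius C of the RKHS ([rkhs_bias]), so |G v|^2 is at least
    |v|^2 / 2 - n C^2 / eta ([filtered_energy_ge]).  The stopping rule is the
    first time at which n < eta sqrt (N(eta)), that is, at which the bias n / eta
    falls below the noise level sqrt (N(eta)); a signal with |v|^2 of larger
    order is detected.

    All orders of magnitude are powers of r = n^(1/(4m+1)).  They follow from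
    N(eta) being of order r^2 at eta of order r^(4m)
    ([stopping_time_exists]).  The upper bound on N holds for every design: the
    first s eigenfunctions contribute at most 1 each and the others at most
    their share of the trace ([effective_dimension_le]).  The lower bound holds
    when the Gram matrix of the first s eigenfunctions on the sample, with s of
    order r^2, is within 1/(2s) of the identity entrywise ([sum_min_ge]).  By
    Hoeffding's inequality and a union bound this fails with probability at most
    2 s^2 exp (- const n / s^2) ([gram_concentration]).  As m > 3/2, n / s^2 is
    at least r^3, so the failure probability is below exp (- r^2) for large n
    ([gram_failure_small]), and r^2 = n^(2/(4m+1)).

    Finally, the noise being independent of the design, a regular conditional
    distribution of the noise given the design is its unconditional law off a
    null set of designs ([conditional_law_ae]), so the conditional power is a
    probability about unconditional Gaussian noise. *)

(** * Means and change of variables *)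

Section change_of_variables_density.
Context d1 d2 (O : measurableType d1) (T : measurableType d2) (R : realType).
Variables (P : {measure set O -> \bar R}) (nu : {measure set T -> \bar R}).
Variables (X : O -> T) (mX : measurable_fun setT X).
Variables (w : O -> R) (mw : measurable_fun setT w) (w0 : forall x, 0 <= w x).
Variable c : R.
Local Open Scope ereal_scope.
Hypothesis Pnu : forall A, measurable A ->
  \int[P]_x ((\1_A (X x) : R) * w x)%:E = c%:E * nu A.

Import HBNNSimple.

Let nnsfun_case (h : {nnsfun T >-> R}) :
  \int[P]_x (h (X x) * w x)%:E = c%:E * \int[nu]_y (h y)%:E.
Proof.
have mind r : measurable_fun setT (fun y => (r * \1_(h @^-1` [set r]) y)%R).
  exact: measurable_funM.
transitivity (\int[P]_x
    (\sum_(r \in range h) (r * (\1_(h @^-1` [set r]) (X x) * w x))%:E)).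
  apply: eq_integral => x _; rewrite fsumEFin// fimfunE; congr EFin.
  by rewrite mulrC mulr_fsumr; apply: eq_fsbigr => r _; rewrite mulrC mulrA.
have me r : measurable_fun setT
    (fun x => (r * (\1_(h @^-1` [set r]) (X x) * w x))%:E).
  apply/measurable_EFinP; apply: measurable_funM => //.
  by apply: measurable_funM => //; apply: (measurableT_comp _ mX).
have e0 r x : 0 <= (r * (\1_(h @^-1` [set r]) (X x) * w x))%:E.
  by rewrite mulrA EFinM mule_ge0 ?lee_fin// -lee_fin nnfun_muleindic_ge0.
rewrite ge0_integral_fsum//.
transitivity (c%:E * (\sum_(r \in range h) \int[nu]_y (r * \1_(h @^-1` [set r]) y)%:E)).
  rewrite ge0_mule_fsumr; last first.
    by move=> r; apply: integral_ge0 => y _; exact: nnfun_muleindic_ge0.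
  apply: eq_fsbigr => r /[!inE] -[y _ <-].
  under eq_integral do rewrite EFinM.
  rewrite ge0_integralZl//; last 3 first.
  - apply/measurable_EFinP/measurable_funM => //.
    exact: (measurableT_comp _ mX).
  - by move=> x _; rewrite lee_fin mulr_ge0.
  - by rewrite lee_fin.
  under [in RHS]eq_integral do rewrite EFinM.
  rewrite ge0_integralZl//; last 2 first.
  - exact/measurable_EFinP.
  - by rewrite lee_fin.
  by rewrite integral_indic// setIT Pnu// muleCA.
congr *%E; rewrite -ge0_integral_fsum//.
- by apply: eq_integral => y _; rewrite fsumEFin// -fimfunE.
- by move=> r; exact/measurable_EFinP.
- by move=> r y _; exact: nnfun_muleindic_ge0.
Qed.

(** Simple functions reduce this to indicators, and monotone convergence does
    the rest.  Two weights [w] are used: a density, with [X] the identity, and,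
    for independent variables, the product of all factors but one. *)
Lemma ge0_integral_density (h : T -> R) : measurable_fun setT h ->
  (forall y, 0 <= h y)%R ->
  \int[P]_x (h (X x) * w x)%:E = c%:E * \int[nu]_y (h y)%:E.
Proof.
move=> mh h0; have mh' : measurable_fun setT (EFin \o h) by exact/measurable_EFinP.
pose g := nnsfun_approx measurableT mh'.
have gh y : (g n y)%:E @[n --> \oo] --> (h y)%:E.
  by apply: cvg_nnsfun_approx => // x _; rewrite lee_fin.
have nd y m n : (m <= n)%N -> (g m y <= g n y)%R.
  by move=> mn; exact/lefP/nd_nnsfun_approx.
have cL : \int[P]_x (g n (X x) * w x)%:E @[n --> \oo] --> \int[P]_x (h (X x) * w x)%:E.
  rewrite (eq_integral (fun x => limn (fun n => (g n (X x) * w x)%:E))).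
    apply: cvg_monotone_convergence => //.
    - move=> n; apply/measurable_EFinP/measurable_funM => //.
      exact: (measurableT_comp _ mX).
    - by move=> n x _; rewrite lee_fin mulr_ge0.
    - by move=> x _ m n mn; rewrite lee_fin ler_wpM2r// nd.
  move=> x _; apply/esym/cvg_lim => //; rewrite EFinM.
  by under eq_fun do rewrite EFinM; apply: cvgeZr.
have cR : \int[nu]_y (g n y)%:E @[n --> \oo] --> \int[nu]_y (h y)%:E.
  rewrite (eq_integral (fun x => limn (fun n => (g n x)%:E))).
    apply: cvg_monotone_convergence => //.
    - by move=> n; apply/measurable_EFinP.
    - by move=> n x _; rewrite lee_fin.
    - by move=> x _ m n mn; rewrite lee_fin nd.
  by move=> x _; apply/esym/cvg_lim.
have := cvgeZl (isT : c%:E \is a fin_num) cR.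
rewrite (_ : (fun n => _) = fun n => \int[P]_x (g n (X x) * w x)%:E); last first.
  by apply/funext => n; rewrite nnsfun_case.
by move=> cR'; apply: (cvg_unique _ cL cR').
Qed.
End change_of_variables_density.

(** Measurability, integrability and the value of the mean are packaged together,
    so that means combine linearly without side conditions. *)
Definition has_mean d (O : measurableType d) (R : realType)
    (P : {measure set O -> \bar R}) (f : O -> R) (m : R) : Prop :=
  P.-integrable [set: O] (EFin \o f) /\ (\int[P]_w (f w)%:E = m%:E)%E.

Section has_mean.
Context d (O : measurableType d) (R : realType) (P : probability O R).
Implicit Types (f g : O -> R) (m : R).

Lemma has_mean_measurable f m : has_mean P f m -> measurable_fun setT f.
Proof. by case=> /measurable_int /measurable_EFinP. Qed.

Lemma has_mean_cst a : has_mean P (fun=> a) a.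
Proof.
split; first exact: (finite_measure_integrable_cst P).
by rewrite integral_cst//= probability_setT mule1.
Qed.

Lemma has_meanD f g m m' : has_mean P f m -> has_mean P g m' ->
  has_mean P (fun w => f w + g w) (m + m').
Proof.
move=> [fi fm] [gi gm]; split; first exact: (integrableD _ fi gi).
by rewrite EFinD -fm -gm -integralD_EFin.
Qed.

Lemma has_meanZ a f m : has_mean P f m -> has_mean P (fun w => a * f w) (a * m).
Proof.
move=> [fi fm]; split; first exact: (integrableZl _ _ fi).
by under eq_integral do rewrite EFinM; rewrite integralZl// fm -EFinM.
Qed.

Lemma has_meanB f g m m' : has_mean P f m -> has_mean P g m' ->
  has_mean P (fun w => f w - g w) (m - m').
Proof.
move=> fm /(has_meanZ (-1)) gm.
rewrite (_ : (fun w => _) = (fun w => f w + -1 * g w)); last first.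
  by apply/funext => w; rewrite mulN1r.
by have := has_meanD fm gm; rewrite mulN1r.
Qed.

Lemma has_mean_sum (I : Type) (s : seq I) (F : I -> O -> R) (m : I -> R) :
  (forall i, has_mean P (F i) (m i)) ->
  has_mean P (fun w => \sum_(i <- s) F i w) (\sum_(i <- s) m i).
Proof.
move=> Fm; elim: s => [|i s IH].
  rewrite big_nil (_ : (fun w => _) = fun=> 0); first exact: has_mean_cst.
  by apply/funext => w; rewrite big_nil.
rewrite big_cons (_ : (fun w => _) = fun w => F i w + \sum_(j <- s) F j w).
  exact: has_meanD.
by apply/funext => w; rewrite big_cons.
Qed.

Lemma has_mean_le f g m m' : has_mean P f m -> has_mean P g m' ->
  (forall w, f w <= g w) -> m <= m'.
Proof.
move=> [fi fm] [gi gm] fg; rewrite -lee_fin -fm -gm.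
by apply: le_integral => // w _; rewrite lee_fin.
Qed.

Lemma has_mean_uniq f m m' : has_mean P f m -> has_mean P f m' -> m = m'.
Proof. by move=> [_ fm] [_]; rewrite fm => -[]. Qed.

Lemma ge0_has_mean f m : measurable_fun setT f -> (forall w, 0 <= f w) ->
  (\int[P]_w (f w)%:E = m%:E)%E -> has_mean P f m.
Proof.
move=> mf f0 fm; split=> //; apply/integrableP; split; first exact/measurable_EFinP.
rewrite (eq_integral (fun w => (f w)%:E)) ?fm ?ltry// => w _ /=.
by rewrite ger0_norm.
Qed.

Lemma has_mean_dominated f g m : measurable_fun setT f -> has_mean P g m ->
  (forall w, `|f w| <= g w) -> exists m', has_mean P f m'.
Proof.
move=> mf [gi gm] fg.
have fi : P.-integrable setT (EFin \o f).
  apply: le_integrable gi => //; first exact/measurable_EFinP.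
  by move=> w _ /=; rewrite lee_fin (le_trans (fg w))// ler_norm.
exists (fine (\int[P]_w (f w)%:E)%E); split=> //.
by rewrite fineK//; exact: integrable_fin_num.
Qed.

Lemma markov_inequality f m a (A : set O) : has_mean P f m ->
  measurable A -> (forall w, 0 <= f w) -> (forall w, A w -> a <= f w) ->
  (a%:E * P A <= m%:E)%E.
Proof.
move=> [fi fm] mA f0 fa; rewrite -fm.
have -> : (a%:E * P A = \int[P]_w (a * \1_A w)%:E)%E.
  under eq_integral do rewrite EFinM.
  by rewrite integralZl ?integral_indic ?setIT//; exact: integrable_indic.
apply: le_integral => //.
  under eq_fun do rewrite EFinM.
  by apply: integrableZl => //; exact: integrable_indic.
move=> w _; rewrite lee_fin indicE; case: (boolP (w \in A)) => /=.
  by rewrite inE mulr1 => /fa.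
by rewrite mulr0.
Qed.

End has_mean.

Section independence.
Context dO (Omega : measurableType dO) (R : realType) (P : probability Omega R).
Context d (T : measurableType d).
Variable X : nat -> {mfun Omega >-> T}.
Hypothesis X_indep : mutually_independent P X.


Let mXA A i : measurable A -> measurable (X i @^-1` A).
Proof. by move=> mA; exact: measurable_funPTI. Qed.

Let indep_indic (J : seq nat) (A : nat -> set T) : uniq J ->
  (forall i, measurable (A i)) ->
  has_mean P (fun w => \prod_(i <- J) (\1_(A i) (X i w) : R))
             (\prod_(i <- J) fine (P (X i @^-1` A i))).
Proof.
move=> uJ mA.
have E : (fun w => \prod_(i <- J) (\1_(A i) (X i w) : R))
    = \1_(\bigcap_(i in [set` J]) X i @^-1` A i).
  apply/funext => w; rewrite [RHS]indicE bigcap_seq; elim: J {uJ} => [|j J IH].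
    by rewrite !big_nil mem_set.
  by rewrite !big_cons IH indicE in_setI -natrM mulnb.
have mI : measurable (\bigcap_(i in [set` J]) X i @^-1` A i).
  by apply: fin_bigcap_measurable => // i _; exact: mXA.
rewrite E; split; first exact: integrable_indic.
rewrite integral_indic// setIT.
have := X_indep uJ mA; rewrite /= => ->.
elim: J {uJ E mI} => [|j J IH]; first by rewrite !big_nil.
by rewrite !big_cons IH EFinM fineK//; apply: fin_num_measure; exact: mXA.
Qed.

(** Induction on the number of factors that are general functions, the others
    being indicators; the new factor is handled by [ge0_integral_density] with
    the product of the other factors as weight. *)
Let indep_mixed n (h : nat -> T -> R) (m : nat -> R) (J : seq nat)
    (A : nat -> set T) :
  (forall i, measurable_fun setT (h i)) -> (forall i y, 0 <= h i y) ->
  (forall i, has_mean P (h i \o X i) (m i)) ->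
  uniq J -> all (fun j => (n <= j)%N) J -> (forall i, measurable (A i)) ->
  has_mean P (fun w => \prod_(i < n) h i (X i w)
                       * \prod_(i <- J) (\1_(A i) (X i w) : R))
             (\prod_(i < n) m i * \prod_(i <- J) fine (P (X i @^-1` A i))).
Proof.
move=> mh h0 hm; elim: n J A => [|n IH] J A uJ nJ mA.
  rewrite big_ord0 mul1r (_ : (fun w => _) =
    fun w => \prod_(i <- J) (\1_(A i) (X i w) : R)).
    exact: indep_indic.
  by apply/funext => w; rewrite big_ord0 mul1r.
pose W w := \prod_(i < n) h i (X i w) * \prod_(i <- J) (\1_(A i) (X i w) : R).
have nJ' : all (fun j => (n <= j)%N) J.
  by apply: sub_all nJ => j /=; exact: ltnW.
have [Wi Wm] := IH J A uJ nJ' mA.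
have W0 w : 0 <= W w.
  by rewrite mulr_ge0//; apply: prodr_ge0.
set c := _ * _ in Wm.
have mW : measurable_fun setT W by exact: (has_mean_measurable (conj Wi Wm)).
pose nu : {measure set T -> \bar R} := distribution P (X n).
have key B : measurable B ->
    (\int[P]_x ((\1_B (X n x) : R) * W x)%:E = c%:E * nu B)%E.
  move=> mB; pose A' j := if j == n then B else A j.
  have nnJ : n \notin J.
    by apply/negP => /(allP nJ); rewrite ltnn.
  have AJ : {in J, forall j, A' j = A j}.
    by move=> j jJ; rewrite /A'; case: eqP => // jn; rewrite -jn jJ in nnJ.
  have [] := IH (n :: J) A' _ _ _.
  - by rewrite /= nnJ.
  - by rewrite /= leqnn.
  - by move=> i; rewrite /A'; case: ifP.
  move=> _; rewrite big_cons/= {2}/A' eqxx.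
  rewrite (eq_big_seq (fun i => fine (P (X i @^-1` A i)))); last first.
    by move=> j jJ; rewrite AJ.
  move=> E2; have fB : P (X n @^-1` B) \is a fin_num.
    by apply: fin_num_measure; exact: mXA.
  transitivity ((c * fine (P (X n @^-1` B)))%:E); last by rewrite EFinM fineK.
  rewrite -mulrA [_ * fine _]mulrC; rewrite -E2.
  apply: eq_integral => w _; congr EFin; rewrite big_cons {1}/A' eqxx.
  rewrite mulrCA; congr (_ * (_ * _)).
  by apply: eq_big_seq => j jJ; rewrite AJ.
have := ge0_integral_density (measurable_funPT (X n)) mW W0 key (mh n) (h0 n).
rewrite ge0_integral_distribution//=; last 2 first.
  exact/measurable_EFinP.
  by move=> y; rewrite lee_fin.
have [_ /= ->] := hm n; rewrite -EFinM => E.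
rewrite big_ord_recr/= mulrAC -/c; apply: ge0_has_mean.
- apply: measurable_funM; last first.
    apply: measurable_prod => j _.
    exact: (measurableT_comp _ (measurable_funPT (X j))).
  apply: measurable_prod => j _.
  exact: (measurableT_comp (mh _) (measurable_funPT (X j))).
- by move=> w; rewrite mulr_ge0//; apply: prodr_ge0.
rewrite -E; apply: eq_integral => w _; congr EFin.
by rewrite big_ord_recr/= mulrAC mulrC.
Qed.

Lemma independent_ge0_prod n (h : nat -> T -> R) (m : nat -> R) :
  (forall i, measurable_fun setT (h i)) -> (forall i y, 0 <= h i y) ->
  (forall i, has_mean P (h i \o X i) (m i)) ->
  has_mean P (fun w => \prod_(i < n) h i (X i w)) (\prod_(i < n) m i).
Proof.
move=> mh h0 hm.
have := indep_mixed mh h0 hm (isT : uniq [::]) (isT : all (fun j => n <= j)%N [::])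
  (fun=> measurable0 : measurable (set0 : set T)).
rewrite big_nil mulr1 (_ : (fun w => _) = (fun w => \prod_(i < n) h i (X i w)))//.
by apply/funext => w; rewrite big_nil mulr1.
Qed.

Lemma has_mean_funpn (h : T -> R) i a : measurable_fun setT h ->
  has_mean P (h \o X i) a ->
  exists p q, [/\ has_mean P (h^\+ \o X i) p, has_mean P (h^\- \o X i) q & a = p - q].
Proof.
move=> mh ha; have mX := measurable_funPT (X i).
have [hi _] := ha.
have hn : has_mean P (fun w => `|h (X i w)|) (fine (\int[P]_w `|h (X i w)|%:E)%E).
  split; first exact: (integrable_norm hi).
  rewrite fineK//; apply: integrable_fin_num => //; exact: (integrable_norm hi).
have [p hp] : exists p, has_mean P (h^\+ \o X i) p.
  apply: has_mean_dominated hn _.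
    by apply: (measurableT_comp _ mX); exact: measurable_funrpos.
  by move=> w; rewrite /= ger0_norm ?funrpos_ge0// /funrpos ge_max ler_norm normr_ge0.
have [q hq] : exists q, has_mean P (h^\- \o X i) q.
  apply: has_mean_dominated hn _.
    by apply: (measurableT_comp _ mX); exact: measurable_funrneg.
  by move=> w; rewrite /= ger0_norm ?funrneg_ge0// /funrneg ge_max -normrN ler_norm normr_ge0.
exists p, q; split=> //; apply: has_mean_uniq ha _.
rewrite (_ : h \o X i = fun w => (h^\+ \o X i) w - (h^\- \o X i) w).
  exact: has_meanB.
by apply/funext => w/=; rewrite -[in LHS](funrposBneg h).
Qed.

(** Linearity extends the nonnegative case, one signed factor at a time. *)
Lemma independent_prod n (h : nat -> T -> R) (m : nat -> R) :
  (forall i, measurable_fun setT (h i)) ->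
  (forall i, has_mean P (h i \o X i) (m i)) ->
  has_mean P (fun w => \prod_(i < n) h i (X i w)) (\prod_(i < n) m i).
Proof.
move=> mh hm.
(* only the factors of index below k may still change sign *)
suff H k h' m' : (forall i, measurable_fun setT (h' i)) ->
  (forall i, has_mean P (h' i \o X i) (m' i)) ->
  (forall i y, (k <= i < n)%N -> 0 <= h' i y) ->
  has_mean P (fun w => \prod_(i < n) h' i (X i w)) (\prod_(i < n) m' i).
  by apply: (H n) => // i y; rewrite leqNgt andNb.
elim: k h' m' => [|k IH] h' m' mh' hm' h0.
  pose h2 i := if (i < n)%N then h' i else fun=> 0.
  pose m2 i := if (i < n)%N then m' i else 0.
  rewrite (eq_bigr (fun i : 'I_n => m2 i)); last by move=> i _; rewrite /m2 ltn_ord.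
  rewrite (_ : (fun w => _) = (fun w => \prod_(i < n) h2 i (X i w))).
    apply: independent_ge0_prod.
    - by move=> i; rewrite /h2; case: ifP.
    - by move=> i y; rewrite /h2; case: ifP => // ilt; apply: h0.
    - by move=> i; rewrite /h2 /m2; case: ifP => // _; exact: has_mean_cst.
  by apply/funext => w; apply: eq_bigr => i _; rewrite /h2 ltn_ord.
have [nk|kn] := leqP n k.
  apply: IH => // i y /andP[ki]; rewrite ltnNge => /negP; case; exact: leq_trans ki.
have [p [q [hp hq mpq]]] := has_mean_funpn (mh' k) (hm' k).
pose hP i := if i == k then (h' k)^\+ else h' i.
pose hN i := if i == k then (h' k)^\- else h' i.
pose mP i := if i == k then p else m' i.
pose mN i := if i == k then q else m' i.
have HP : has_mean P (fun w => \prod_(i < n) hP i (X i w)) (\prod_(i < n) mP i).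
  apply: IH.
  - by move=> i; rewrite /hP; case: eqP => // _; exact: measurable_funrpos.
  - by move=> i; rewrite /hP /mP; case: eqP => // ->.
  - move=> i y /andP[ki ilt]; rewrite /hP; case: eqP => [_|/eqP ik]; first exact: funrpos_ge0.
    by apply: h0; rewrite ilt ltn_neqAle eq_sym ik ki.
have HN : has_mean P (fun w => \prod_(i < n) hN i (X i w)) (\prod_(i < n) mN i).
  apply: IH.
  - by move=> i; rewrite /hN; case: eqP => // _; exact: measurable_funrneg.
  - by move=> i; rewrite /hN /mN; case: eqP => // ->.
  - move=> i y /andP[ki ilt]; rewrite /hN; case: eqP => [_|/eqP ik]; first exact: funrneg_ge0.
    by apply: h0; rewrite ilt ltn_neqAle eq_sym ik ki.
have split3 (a b c : nat -> R) : a k = b k - c k ->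
    (forall i, i != k -> a i = b i) -> (forall i, i != k -> a i = c i) ->
    \prod_(i < n) a i = \prod_(i < n) b i - \prod_(i < n) c i.
  move=> abc ab ac; rewrite (bigD1 (Ordinal kn))//= abc mulrBl.
  rewrite [in RHS](bigD1 (Ordinal kn))//= [X in _ = _ - X](bigD1 (Ordinal kn))//=.
  by congr (_ * _ - _ * _); apply: eq_bigr => i; rewrite -val_eqE/= => ik;
    [exact: ab|exact: ac].
rewrite (split3 m' mP mN).
- rewrite (_ : (fun w => _) = (fun w => \prod_(i < n) hP i (X i w)
    - \prod_(i < n) hN i (X i w))); first exact: has_meanB.
  apply/funext => w; apply: (split3 (fun i => h' i (X i w))
     (fun i => hP i (X i w)) (fun i => hN i (X i w))).
  + by rewrite /hP /hN eqxx -[in LHS](funrposBneg (h' k)).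
  + by move=> i /negbTE ik; rewrite /hP ik.
  + by move=> i /negbTE ik; rewrite /hN ik.
- by rewrite /mP /mN eqxx.
- by move=> i /negbTE ik; rewrite /mP ik.
- by move=> i /negbTE ik; rewrite /mN ik.
Qed.

End independence.

(** * Moments of the standard Gaussian *)

Section gaussian_moments.
Variable R : realType.
Local Notation leb := (@lebesgue_measure R).
Local Notation gauss := (normal_prob (R := R) 0 1).
Let p : R -> R := normal_pdf 0 1.

Let pE x : p x = normal_peak 1 * expR (- (x ^+ 2 / 2)).
Proof.
rewrite /p normal_pdfE ?oner_eq0// /normal_fun subr0 expr1n.
by congr (_ * expR _); rewrite mulNr.
Qed.

Let is_derive_p (x : R) : is_derive x 1 p (- x * p x).
Proof.
rewrite (_ : p = cst (normal_peak 1) * (expR \o (- ((@id R) ^+ 2 * cst (2^-1))))); last first.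
  by apply/funext => y; rewrite pE !fctE.
pose g : R -> R := - ((@id R) ^+ 2 * cst (2^-1)).
have dg : is_derive x 1 g (- x).
  apply: is_derive_eq; rewrite !scaler0 add0r /cst /GRing.scale/=.
  by field.
apply: is_derive_eq.
rewrite scaler0 addr0.
change (normal_peak 1 * (expR (g x) * - x) = - x * (normal_peak 1 * expR (g x)) :> R).
by ring.
Qed.

(** Integration by parts for the moments: minus x^(k+1) times the density is
    an antiderivative of the (k+2)-nd moment integrand minus k+1 times the k-th
    one. *)
Let is_derive_F k (x : R) :
  is_derive x 1 (fun y => - (y ^+ k.+1 * p y)) (x ^+ k.+2 * p x - k.+1%:R * (x ^+ k * p x)).
Proof.
rewrite (_ : (fun y => _) = - ((@id R) ^+ k.+1 * p)); last by apply/funext => y; rewrite !fctE.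
apply: is_derive_eq (is_deriveN (is_deriveM (is_deriveX k.+1 (is_derive_id x 1)) (is_derive_p x))) _.
rewrite exprfctE.
change (- (x ^+ k.+1 * (- x * p x) + p x * ((k.+1%:R * x ^+ k) * 1)) =
  x ^+ k.+2 * p x - k.+1%:R * (x ^+ k * p x)).
by rewrite !exprS; ring.
Qed.

Let cF k : continuous (fun y : R => - (y ^+ k.+1 * p y)).
Proof.
move=> x; have [d _] := is_derive_F k x.
exact/differentiable_continuous/derivable1_diffP.
Qed.

Let cmon k : continuous (fun y : R => y ^+ k * p y).
Proof.
move=> x; apply: cvgM; first exact: exprn_continuous.
exact: continuous_normal_pdf (oner_neq0 _) x.
Qed.

Let cmonZ k (c : R) : continuous (fun y : R => c * (y ^+ k * p y)).
Proof. by move=> x; apply: cvgM; [exact: cvg_cst|exact: cmon]. Qed.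

Let decay k : (k <= 2)%N -> n%:R ^+ k.+1 * p n%:R @[n --> \oo] --> (0 : R).
Proof.
move=> k2; have q0 := normal_peak_ge0 (1 : R).
apply: (@squeeze_cvgr _ _ _ _ (fun=> 0) (fun n => (normal_peak 1 * 8) * n%:R^-1)).
- near=> n; rewrite mulr_ge0 ?exprn_ge0 ?normal_pdf_ge0//= pE.
  have n0 : (0 : R) < n%:R by rewrite ltr0n; near: n; exists 1%N.
  have n1 : (1 : R) <= n%:R by rewrite ler1n -(ltr0n R).
  have : (n%:R ^+ 2 / 2) ^+ 2 / 2 <= expR (n%:R ^+ 2 / 2 : R).
    apply: le_trans (expR_ge1Dxn 1 _); last by rewrite divr_ge0// exprn_ge0// ltW.
    by rewrite lerDr.
  rewrite expRN => h.
  rewrite mulrCA -mulrA ler_wpM2l//.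
  rewrite ler_pdivrMr ?expR_gt0//.
  have : n%:R ^+ k.+1 <= (n%:R ^+ 3 : R) by apply: ler_weXn2l.
  move=> h2; apply: (le_trans h2).
  have -> : n%:R ^+ 3 = 8 / n%:R * ((n%:R ^+ 2 / 2) ^+ 2 / 2) :> R.
    by field; rewrite gt_eqF.
  by rewrite ler_wpM2l// divr_ge0.
- exact: cvg_cst.
- rewrite -(mulr0 (normal_peak 1 * 8)); apply: cvgM; first exact: cvg_cst.
  by rewrite -cvg_shiftS; exact: cvg_harmonic.
Unshelve. all: by end_near. Qed.


Let pge0 x : 0 <= p x. Proof. exact: normal_pdf_ge0. Qed.

Let halfmom k : \bar R := (\int[leb]_(x in `[0%R, +oo[) (`|x| ^+ k * p x)%:E)%E.

Let mabs k : measurable_fun [set: R] (fun x : R => `|x| ^+ k * p x).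
Proof.
apply: measurable_funM; last exact: measurable_normal_pdf.
by apply: measurable_funX; exact: normr_measurable.
Qed.

Let abs0 k x : 0 <= `|x| ^+ k * p x. Proof. by rewrite mulr_ge0 ?exprn_ge0. Qed.

Let FTC k n : (0 < n)%N ->
  ((\int[leb]_(x in `[0%R, n%:R]) (`|x| ^+ k.+2 * p x)%:E) =
   (k.+1%:R)%:E * (\int[leb]_(x in `[0%R, n%:R]) (`|x| ^+ k * p x)%:E)
   - (n%:R ^+ k.+1 * p n%:R)%:E)%E.
Proof.
move=> n0; have n0' : (0 : R) < n%:R by rewrite ltr0n.
pose f x := x ^+ k.+2 * p x - k.+1%:R * (x ^+ k * p x).
have cf : continuous f.
  move=> x; apply: cvgB; first exact: cmon.
  exact: cmonZ.
have := @continuous_FTC2 R f (fun y => - (y ^+ k.+1 * p y)) 0 n%:R n0'.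
rewrite expr0n/= mul0r oppr0 sube0 => H.
have {H} : (\int[leb]_(x in `[0%R, n%:R]) (f x)%:E)%E = (- (n%:R ^+ k.+1 * p n%:R))%:E.
  apply: H.
  - exact: continuous_subspaceT.
  - split.
    + by move=> x _; have [] := is_derive_F k x.
    + by apply: cvg_at_right_filter; exact: cF.
    + by apply: cvg_at_left_filter; exact: cF.
  - move=> x _; rewrite derive1E; have [_ ->] := is_derive_F k x; by [].
have ic j : leb.-integrable `[0, n%:R] (EFin \o (fun y : R => y ^+ j * p y)).
  apply: continuous_compact_integrable; first exact: segment_compact.
  exact: continuous_subspaceT.
have iE j : (\int[leb]_(x in `[0%R, n%:R]) (`|x| ^+ j * p x)%:E =
             \int[leb]_(x in `[0%R, n%:R]) (x ^+ j * p x)%:E)%E.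
  apply: eq_integral => x; rewrite inE/= in_itv/= => /andP[x0 _].
  by rewrite ger0_norm.
rewrite !iE.
rewrite /f; under eq_integral do rewrite EFinB.
rewrite integralB_EFin//; [|exact: (integrableZl _ _ (ic k))].
under [X in (_ - X)%E]eq_integral do rewrite EFinM.
rewrite integralZl//=; last exact: ic.
have fi j : (\int[leb]_(x in `[0%R, n%:R]) (x ^+ j * p x)%:E)%E \is a fin_num.
  by apply: integrable_fin_num => //; exact: ic.
rewrite -(fineK (fi k)) -(fineK (fi k.+2)).
rewrite -!EFinM -!EFinB => -[E]; congr EFin.
by apply/eqP; rewrite -subr_eq0 -E; apply/eqP; ring.
Qed.

(** The boundary term of the integration by parts on [0, n] tends to 0. *)
Let halfmomS k : (k <= 2)%N -> halfmom k \is a fin_num ->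
  halfmom k.+2 = ((k.+1%:R)%:E * halfmom k)%E.
Proof.
move=> k2 fk.
have c1 := ge0_cvgn_integral (mu := leb) (abs0 k.+2) (mabs k.+2).
have c2 := ge0_cvgn_integral (mu := leb) (abs0 k) (mabs k).
rewrite -/(halfmom _) in c1; rewrite -/(halfmom _) in c2.
apply: (cvg_unique _ c1) => //.
have c3 : ((k.+1%:R)%:E * (\int[leb]_(x in `[0%R, n%:R]) (`|x| ^+ k * p x)%:E)
   - (n%:R ^+ k.+1 * p n%:R)%:E)%E @[n --> \oo] --> ((k.+1%:R)%:E * halfmom k)%E.
  rewrite -[X in _ --> X]sube0; apply: cvgeB; first by rewrite fin_num_adde_defl.
    exact: cvgeZl.
  by apply: cvg_EFin; [exact: nearW|exact: decay].
apply: cvg_trans c3; apply: near_eq_cvg.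
by near=> n; rewrite FTC//; near: n; exists 1%N.
Unshelve. all: by end_near. Qed.

Let fullmom k : (\int[leb]_x (`|x| ^+ k * p x)%:E = 2 * halfmom k)%E.
Proof.
rewrite ge0_symfun_integralT//=.
- rewrite (_ : [set x : R | 0 <= x] = `[0%R, +oo[%classic)//.
  by apply/seteqP; split => x /=; rewrite in_itv/= andbT.
- move=> x; apply: cvgM; last exact: continuous_normal_pdf (oner_neq0 _) x.
  apply: (cvg_comp (fun x => `|x|) (fun x => x ^+ k)); first exact: (@norm_continuous R R^o).
  exact: exprn_continuous.
- by move=> x /=; rewrite normrN !pE sqrrN.
Qed.

Let halfmom0 : halfmom 0 = (2^-1)%:E.
Proof.
have := fullmom 0.
under eq_integral do rewrite expr0 mul1r.
rewrite integral_normal_pdf -/(halfmom 0).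
have : (0 <= halfmom 0)%E by apply: integral_ge0 => x _; rewrite lee_fin.
case: (halfmom 0) => [r| |]//=.
  by move=> _ [] E; congr EFin; apply: (mulfI (x := 2)) => //; rewrite mulfV// E.
by move=> _; rewrite gt0_muley// lte_fin.
Qed.

Let halfmom2 : halfmom 2 = (2^-1)%:E.
Proof. by rewrite halfmomS ?halfmom0// mul1e. Qed.

Let halfmom4 : halfmom 4 = (3 / 2)%:E.
Proof. by rewrite halfmomS ?halfmom2. Qed.

Section law.
Context d (O : measurableType d) (P : probability O R) (e : {mfun O >-> R}).
Hypothesis e_law : forall A, measurable A -> P (e @^-1` A) = gauss A.

Let integral_law (h : R -> R) : measurable_fun setT h -> (forall y, 0 <= h y) ->
  (\int[P]_w (h (e w))%:E = \int[leb]_y (h y * p y)%:E)%E.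
Proof.
move=> mh h0.
have -> : (\int[P]_w (h (e w))%:E = \int[gauss]_y (h y)%:E)%E.
  transitivity (\int[P]_w (h (e w) * cst 1 w)%:E)%E.
    by apply: eq_integral => w _; rewrite /cst mulr1.
  rewrite (@ge0_integral_density _ _ _ _ _ P gauss e _ (cst 1) _ _ 1)//.
  - by rewrite mul1e.
  - exact: (measurable_funPT e).
  - move=> A mA; under eq_integral do rewrite /cst mulr1.
    have mE : measurable (e @^-1` A) by exact: measurable_funPTI.
    transitivity (P (e @^-1` A)); last by rewrite mul1e; exact: e_law.
    have := integral_indic P measurableT mE; rewrite setIT => <-.
    by apply: eq_integral => w _; congr EFin.
symmetry; rewrite (@ge0_integral_density _ _ _ _ _ leb gauss id _ p _ _ 1)//.
- by rewrite mul1e.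
- exact: measurable_normal_pdf.
- move=> A mA; rewrite mul1e /normal_prob [RHS]integral_mkcond.
  apply: eq_integral => x _; rewrite patchE indicE /=.
  by case: (boolP (x \in A)) => xA; rewrite ?mul1r ?mul0r.
Qed.

Let abs_mean k r : halfmom k = r%:E -> has_mean P (fun w => `|e w| ^+ k) (2 * r).
Proof.
move=> kr; have mk : measurable_fun setT (fun y : R => `|y| ^+ k).
  by apply: measurable_funX; exact: normr_measurable.
apply: ge0_has_mean.
- exact: (measurableT_comp mk (measurable_funPT e)).
- by move=> w; rewrite exprn_ge0.
- rewrite (integral_law mk); last by move=> y; rewrite exprn_ge0.
  by rewrite fullmom kr.
Qed.

Lemma gaussian_mean2 : has_mean P (fun w => e w ^+ 2) 1.
Proof.
have := abs_mean halfmom2; rewrite mulfV//.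
by under eq_fun do rewrite real_normK ?num_real//.
Qed.

Lemma gaussian_mean4 : has_mean P (fun w => e w ^+ 4) 3.
Proof.
have := abs_mean halfmom4; rewrite mulrCA mulfV// mulr1.
under eq_fun => w do rewrite (exprM _ 2 2) real_normK ?num_real// -exprM.
by [].
Qed.

Lemma gaussian_mean3 : exists m3, has_mean P (fun w => e w ^+ 3) m3.
Proof.
apply: (has_mean_dominated _ (has_meanD gaussian_mean2 gaussian_mean4)).
  by apply: measurable_funX; exact: measurable_funPT.
move=> w; rewrite normrX; set t := e w.
have -> : t ^+ 2 = `|t| ^+ 2 by rewrite real_normK ?num_real.
have -> : t ^+ 4 = `|t| ^+ 4 by rewrite [RHS](exprM _ 2 2) real_normK ?num_real// -exprM.
have := normr_ge0 t; move: `|t| => u u0; nra.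
Qed.

(** The density is even, so the positive and negative parts of the variable
    have the same mean. *)
Lemma gaussian_mean1 : has_mean P e 0.
Proof.
pose pos (y : R) := Num.max y 0; pose neg (y : R) := Num.max (- y) 0.
have mpos : measurable_fun setT pos by exact: measurable_maxr.
have mneg : measurable_fun setT neg by exact: measurable_maxr.
have pos0 y : 0 <= pos y by rewrite le_max lexx orbT.
have neg0 y : 0 <= neg y by rewrite le_max lexx orbT.
have mc (h : R -> R) : measurable_fun setT h -> measurable_fun setT (fun w => h (e w)).
  by move=> mh; exact: (measurableT_comp mh (measurable_funPT e)).
have dom (h : R -> R) : measurable_fun setT h -> (forall y : R, `|h y| <= `|y|) ->
    exists m', has_mean P (fun w => h (e w)) m'.
  move=> mh hy; apply: (has_mean_dominated (mc _ mh) (has_meanD (has_mean_cst P 1) gaussian_mean2)).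
  move=> w; apply: (le_trans (hy _)); set t := e w.
  have -> : t ^+ 2 = `|t| ^+ 2 by rewrite real_normK ?num_real.
  have := normr_ge0 t; move: `|t| => u u0; nra.
have [a ha] : exists m', has_mean P (fun w => pos (e w)) m'.
  apply: dom => // y; rewrite ger0_norm// /pos ge_max ler_norm normr_ge0//.
have [b hb] : exists m', has_mean P (fun w => neg (e w)) m'.
  apply: dom => // y; rewrite ger0_norm// /neg ge_max -normrN ler_norm normr_ge0//.
suff ab : a = b.
  rewrite (_ : MeasurableFun.sort e = fun w => pos (e w) - neg (e w)).
    by rewrite -(subrr b) -{1}ab; exact: has_meanB.
  apply/funext => w; rewrite /pos /neg.
  by have [h|h] := leP 0 (e w); rewrite ?maxr_pMl; rewrite /Num.max; do ?case: ifP; lra.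
apply: EFin_inj; rewrite -ha.2 -hb.2 !integral_law//.
have pN y : p (- y) = p y by rewrite !pE sqrrN.
have Epos : (\int[leb]_y (pos y * p y)%:E = \int[leb]_(y in `[0%R, +oo[) (pos y * p y)%:E)%E.
  rewrite [RHS]integral_mkcond; apply: eq_integral => y _; rewrite patchE.
  case: ifPn => //; rewrite notin_setE/= in_itv/= andbT => /negP; rewrite -ltNge => y0.
  by rewrite /pos max_r ?mul0r// ltW.
have Eneg : (\int[leb]_y (neg y * p y)%:E = \int[leb]_(y in `]-oo, 0%R]) (neg y * p y)%:E)%E.
  rewrite [RHS]integral_mkcond; apply: eq_integral => y _; rewrite patchE.
  case: ifPn => //; rewrite notin_setE/= in_itv/= => /negP; rewrite -ltNge => y0.
  by rewrite /neg max_r ?mul0r// oppr_le0 ltW.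
rewrite Epos Eneg (@ge0_integration_by_substitution0 _ (fun y => (pos y * p y)%:E)).
- by apply: eq_integral => y _; rewrite pN.
- by apply/measurable_EFinP/measurable_funM => //; exact: measurable_normal_pdf.
- by move=> y; rewrite lee_fin mulr_ge0.
Qed.

End law.
End gaussian_moments.

(** * Quadratic forms in Gaussian noise *)

Section quadratic_form.
Context dO (Omega : measurableType dO) (R : realType) (P : probability Omega R).
Variable eps : nat -> {mfun Omega >-> R}.
Hypothesis eps_iid : iid P eps (normal_prob 0 1).
Variable n : nat.
Implicit Types i j k l : 'I_n.

Let third_moments : exists m3 : nat -> R, forall q : nat, has_mean P (fun w => eps q w ^+ 3) (m3 q).
Proof.
have [f fP] := choice (fun q : nat => gaussian_mean3 (e := eps q) (eps_iid.2 q)).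
by exists f.
Qed.

(** Factors with equal indices are grouped into powers, and powers with
    different indices are independent. *)
Lemma gaussian_monomial (s : seq 'I_n) (mom : nat -> nat -> R) :
  (forall q c, (c <= size s)%N -> has_mean P (fun w => eps q w ^+ c) (mom q c)) ->
  has_mean P (fun w => \prod_(i <- s) eps i w) (\prod_(q : 'I_n) mom q (count_mem q s)).
Proof.
move=> momP.
pose c (q : nat) : nat := count [pred i : 'I_n | val i == q] s.
have cE (q : 'I_n) : c q = count_mem q s by apply: eq_count => i /=.
rewrite (_ : (fun w => _) = fun w => \prod_(q < n) (eps q w ^+ c q)).
  under eq_bigr do rewrite -cE.
  apply: (@independent_prod _ _ _ _ _ _ _ eps_iid.1 n (fun q y => y ^+ c q)
    (fun q => mom q (c q))).
    by move=> q; exact: exprn_measurable.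
  by move=> q; apply: momP; exact: count_size.
apply/funext => w; under [RHS]eq_bigr do rewrite cE.
elim: s {momP c cE} => [|i s IH].
  by rewrite big_nil big1.
rewrite big_cons IH (bigD1 i)//= [RHS](bigD1 i)//= eqxx add1n exprS -mulrA.
congr (_ * (_ * _)); apply: eq_bigr => q qi; by rewrite eq_sym (negbTE qi).
Qed.

Let mom_prod (mom : nat -> nat -> R) (s : seq 'I_n) : (forall q, mom q 0%N = 1) ->
  \prod_(q : 'I_n) mom q (count_mem q s) = \prod_(q <- undup s) mom q (count_mem q s).
Proof.
move=> m0; rewrite (bigID (mem (undup s)))/= [X in _ * X]big1 ?mulr1.
  by rewrite big_uniq ?undup_uniq.
by move=> q; rewrite mem_undup => /count_memPn ->.
Qed.

Let moments : exists2 mom : nat -> nat -> R,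
  [/\ forall q, mom q 0%N = 1, forall q, mom q 1%N = 0,
      forall q, mom q 2%N = 1 & forall q, mom q 4%N = 3] &
  forall q c, (c <= 4)%N -> has_mean P (fun w => eps q w ^+ c) (mom q c).
Proof.
have [m3 m3P] := third_moments.
exists (fun q c => nth 0 [:: 1; 0; 1; m3 q; 3] c); first by split.
move=> q; have law := eps_iid.2 q.
case=> [_|[_|[_|[_|[_|//]]]]] /=.
- by under eq_fun do rewrite expr0; exact: has_mean_cst.
- by under eq_fun do rewrite expr1; exact: gaussian_mean1.
- exact: gaussian_mean2.
- exact: m3P.
- exact: gaussian_mean4.
Qed.

Lemma gaussian_mean_prod2 i j :
  has_mean P (fun w => eps i w * eps j w) (i == j)%:R.
Proof.
have [mom [m0 m1 m2 m4] momP] := moments.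
have := @gaussian_monomial [:: i; j] mom (fun q c h => momP q c (leq_trans h (isT : (2 <= 4)%N))).
rewrite mom_prod//; under eq_fun do rewrite !big_cons big_nil mulr1.
suff -> : \prod_(q <- undup [:: i; j]) mom q (count_mem q [:: i; j]) = (i == j)%:R by [].
rewrite /= !inE; case: (eqVneq i j) => [->|ij] /=.
  by rewrite big_seq1 eqxx m2.
by rewrite !big_cons big_nil !eqxx (negbTE ij) eq_sym (negbTE ij) /= !m1 mul0r.
Qed.

(** Isserlis' formula, by inspection of all patterns of equalities between the
    four indices; the third moment only ever multiplies a first moment. *)
Lemma isserlis4 i j k l :
  has_mean P (fun w => eps i w * eps j w * (eps k w * eps l w))
   ((i == j)%:R * (k == l)%:R + (i == k)%:R * (j == l)%:R + (i == l)%:R * (j == k)%:R).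
Proof.
have [mom [m0 m1 m2 m4] momP] := moments.
have := @gaussian_monomial [:: i; j; k; l] mom (fun q c h => momP q c h).
rewrite mom_prod//; under eq_fun do rewrite !big_cons big_nil mulr1 mulrA.
set lhs := \prod_(q <- _) _; set rhs := (X in _ -> has_mean P _ X).
suff -> : lhs = rhs by [].
rewrite /lhs /rhs {lhs rhs} /= !inE.
have sym (a b : 'I_n) : a != b -> (b == a) = false by rewrite eq_sym => /negbTE.
case: (eqVneq i j) => [ij|ij]; case: (eqVneq i k) => [ik|ik]; case: (eqVneq i l) => [il|il];
case: (eqVneq j k) => [jk|jk]; case: (eqVneq j l) => [jl|jl]; case: (eqVneq k l) => [kl|kl];
subst => //=;
try (match goal with H : is_true (?x != ?x) |- _ => by rewrite eqxx in H end);
rewrite ?big_cons ?big_nil /= ?eqxx ?(sym _ _ ij) ?(sym _ _ ik) ?(sym _ _ il) ?(sym _ _ jk) ?(sym _ _ jl) ?(sym _ _ kl) ?(negbTE ij) ?(negbTE ik) ?(negbTE il) ?(negbTE jk) ?(negbTE jl) ?(negbTE kl) /= ?big_cons ?big_nil /=;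
rewrite ?(m4, m1, m2) ?(mul0r, mulr0, mul1r, mulr1, add0r, addr0)//; ring.
Qed.

(** By [isserlis4], the covariance of e_i e_j and e_k e_l is the sum of the
    indicators of (i, j) = (k, l) and (i, j) = (l, k); each of them contributes
    the squared Frobenius norm of the symmetric matrix [B]. *)
Lemma quadratic_form_second_moment (B : 'M[R]_n) : B^T = B ->
  has_mean P (fun w => (\sum_i \sum_j B i j * (eps i w * eps j w - (i == j)%:R)) ^+ 2)
             (2 * \sum_i \sum_j B i j ^+ 2).
Proof.
move=> symB.
have term i j k l : has_mean P
    (fun w => (eps i w * eps j w - (i == j)%:R) * (eps k w * eps l w - (k == l)%:R))
    ((i == k)%:R * (j == l)%:R + (i == l)%:R * (j == k)%:R).
  rewrite (_ : (fun w => _) = fun w => (eps i w * eps j w * (eps k w * eps l w)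
     - (k == l)%:R * (eps i w * eps j w)) - ((i == j)%:R * (eps k w * eps l w)
     - (i == j)%:R * (k == l)%:R)); last by apply/funext => w; ring.
  rewrite (_ : _ + _ = ((i == j)%:R * (k == l)%:R + (i == k)%:R * (j == l)%:R
     + (i == l)%:R * (j == k)%:R - (k == l)%:R * (i == j)%:R)
     - ((i == j)%:R * (k == l)%:R - (i == j)%:R * (k == l)%:R) :> R); last by ring.
  apply: has_meanB; apply: has_meanB.
  - exact: isserlis4.
  - by apply: has_meanZ; exact: gaussian_mean_prod2.
  - by apply: has_meanZ; exact: gaussian_mean_prod2.
  - exact: has_mean_cst.
rewrite (_ : (fun w => _) = fun w => \sum_i \sum_j \sum_k \sum_l (B i j * B k l) *
   ((eps i w * eps j w - (i == j)%:R) * (eps k w * eps l w - (k == l)%:R))); last first.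
  apply/funext => w; rewrite expr2 mulr_suml; apply: eq_bigr => i _.
  rewrite mulr_suml; apply: eq_bigr => j _; rewrite mulr_sumr; apply: eq_bigr => k _.
  by rewrite mulr_sumr; apply: eq_bigr => l _; ring.
rewrite (_ : 2 * _ = \sum_i \sum_j \sum_k \sum_l (B i j * B k l) *
   ((i == k)%:R * (j == l)%:R + (i == l)%:R * (j == k)%:R)); last first.
  rewrite mulr_sumr; apply: eq_bigr => i _; rewrite mulr_sumr; apply: eq_bigr => j _.
  transitivity (\sum_k (B i j * B k j * (i == k)%:R + B i j * B k i * (j == k)%:R)).
    rewrite big_split/= (bigD1 i)//= big1 ?addr0; last first.
      by move=> k ki; rewrite eq_sym (negbTE ki) mulr0.
    rewrite (bigD1 j)//= [X in _ + (_ + X)]big1 ?addr0; last first.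
      by move=> k ki; rewrite eq_sym (negbTE ki) mulr0.
    have Bji : B j i = B i j by rewrite -[in LHS]symB mxE.
    by rewrite !eqxx Bji !mulr1 mulr_natl mulr2n expr2.
  apply: eq_bigr => k _.
  under [RHS]eq_bigr do rewrite mulrDr.
  rewrite big_split/=; congr (_ + _).
    rewrite (bigD1 j)//= big1 ?addr0 ?eqxx ?mulr1//.
    by move=> l lj; rewrite [j == l]eq_sym (negbTE lj) !mulr0.
  rewrite (bigD1 i)//= big1 ?addr0 ?eqxx ?mul1r//.
  by move=> l lj; rewrite [i == l]eq_sym (negbTE lj) mul0r mulr0.
by do 4 (apply: has_mean_sum => ?); apply: has_meanZ.
Qed.

Lemma linear_form_second_moment (p : 'I_n -> R) :
  has_mean P (fun w => (\sum_i p i * eps i w) ^+ 2) (\sum_i p i ^+ 2).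
Proof.
rewrite (_ : (fun w => _) = fun w => \sum_i \sum_j (p i * p j) * (eps i w * eps j w)); last first.
  apply/funext => w; rewrite expr2 mulr_suml; apply: eq_bigr => i _.
  by rewrite mulr_sumr; apply: eq_bigr => j _; ring.
rewrite (_ : \sum_i _ = \sum_i \sum_j (p i * p j) * (i == j)%:R); last first.
  apply: eq_bigr => i _; rewrite (bigD1 i)//= big1 ?addr0 ?eqxx ?mulr1//.
  by move=> j ji; rewrite eq_sym (negbTE ji) mulr0.
by do 2 (apply: has_mean_sum => ?); apply: has_meanZ; exact: gaussian_mean_prod2.
Qed.

(** The correlation between the quadratic and the linear form is absorbed by
    (x + y)^2 <= 2 x^2 + 2 y^2, at the price of a factor 2. *)
Lemma quadratic_chebyshev (B : 'M[R]_n) (p : 'I_n -> R) (t : R) (A : set Omega) :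
  B^T = B -> measurable A -> 0 < t ->
  (forall w, A w -> t <= `|\sum_i \sum_j B i j * (eps i w * eps j w - (i == j)%:R)
                    + \sum_i p i * eps i w|) ->
  (P A <= ((4 * (\sum_i \sum_j B i j ^+ 2) + 2 * (\sum_i p i ^+ 2)) / t ^+ 2)%:E)%E.
Proof.
move=> symB mA t0 At.
have := has_meanD (has_meanZ 2 (quadratic_form_second_moment symB))
                  (has_meanZ 2 (linear_form_second_moment p)).
move=> /markov_inequality -/(_ (t ^+ 2) A mA) H.
rewrite mulrC EFinM lee_pdivlMl ?exprn_gt0//.
rewrite (_ : 4 * _ = 2 * (2 * (\sum_i \sum_j B i j ^+ 2))); last by ring.
apply: H => w.
  by rewrite addr_ge0// mulr_ge0// sqr_ge0.
move=> /At; set a := (X in `|X + _|); set b := (X in `|_ + X|) => tab.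
have : t ^+ 2 <= (a + b) ^+ 2.
  by rewrite -[leRHS]real_normK ?num_real// lerXn2r// nnegrE// ltW.
rewrite -/a -/b; have := sqr_ge0 (a - b); nra.
Qed.

End quadratic_form.

(** * Exponential concentration of bounded averages *)

Section hoeffding.
Context dO (Omega : measurableType dO) (R : realType) (P : probability Omega R).
Context d (T : measurableType d).
Variable X : nat -> {mfun Omega >-> T}.
Hypothesis X_indep : mutually_independent P X.

Lemma expR_le_quadratic (u : R) : `|u| <= 2^-1 -> expR u <= 1 + u + 2 * u ^+ 2.
Proof.
rewrite ler_norml => /andP[u1 u2].
have h := expR_ge1Dx (- u).
have e0 := expR_gt0 u.
have : expR u * (1 - u) <= 1.
  by rewrite -[leRHS](expRxMexpNx_1 u) ler_wpM2l// ltW.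
nra.
Qed.

(** Chernoff's method: as u <= 1/2 gives e^u <= 1 + u + 2 u^2, the exponential
    moment of each centered term is at most exp (2 t^2 b^2). *)
Lemma hoeffding_upper (g : T -> R) (b dl : R) n :
  measurable_fun setT g -> (forall y, `|g y| <= b) ->
  (forall i, has_mean P (g \o X i) 0) -> 0 < b -> 0 <= dl <= 2 * b ->
  (P [set w | (n%:R * dl <= \sum_(i < n) g (X i w))%R]
     <= (expR (- (n%:R * dl ^+ 2 / (8 * b ^+ 2))))%:E)%E.
Proof.
move=> mg gb gm b0 /andP[dl0 dlb].
(* minimizer of - t dl + 2 t^2 b^2 *)
pose t := dl / (4 * b ^+ 2).
have t0 : 0 <= t by rewrite divr_ge0// mulr_ge0// exprn_ge0// ltW.
have tb : t * b <= 2^-1.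
  have -> : t * b = (dl / (2 * b)) / 2 by rewrite /t; field; rewrite gt_eqF.
  by rewrite -[leRHS]mul1r ler_wpM2r// ler_pdivrMr ?mul1r// mulr_gt0.
pose h y := expR (t * g y).
have mh : measurable_fun setT h.
  by apply: (measurableT_comp (@measurable_expR R)); exact: measurable_funM.
have hq y : h y <= 1 + t * g y + 2 * (t * b) ^+ 2.
  have tg : `|t * g y| <= t * b by rewrite normrM ger0_norm// ler_wpM2l.
  apply: le_trans (expR_le_quadratic (le_trans tg tb)) _.
  rewrite lerD2l ler_wpM2l//.
  move: tg; rewrite ler_norml => /andP[]; nra.
pose c := 2 * (t * b) ^+ 2.
have c0 : 0 <= c by rewrite mulr_ge0// exprn_ge0// mulr_ge0// ltW.
have hm i : exists a, has_mean P (h \o X i) a /\ a <= expR c.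
  have H : has_mean P (fun w => 1 + c + t * g (X i w)) (1 + c).
    by have := has_meanD (has_mean_cst P (1 + c)) (has_meanZ t (gm i)); rewrite mulr0 addr0.
  have [a ha] : exists a, has_mean P (h \o X i) a.
    apply: has_mean_dominated H _.
      exact: (measurableT_comp mh (measurable_funPT (X i))).
    move=> w; rewrite ger0_norm ?expR_ge0//=.
    by apply: le_trans (hq _) _; rewrite -/c; lra.
  exists a; split => //; apply: (le_trans _ (expR_ge1Dx c)).
  apply: has_mean_le ha H _ => w /=; apply: le_trans (hq _) _.
  by rewrite -/c; lra.
have [a ha] := choice hm.
have := independent_prod X_indep n (fun=> mh) (fun i => (ha i).1).
have mS : measurable_fun setT (fun w => \sum_(i < n) g (X i w)).
  apply: measurable_sum => i.
  exact: (measurableT_comp mg (measurable_funPT (X i))).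
pose A := [set w | n%:R * dl <= \sum_(i < n) g (X i w)].
have mA : measurable A.
  rewrite (_ : A = (fun w => \sum_(i < n) g (X i w)) @^-1` `[n%:R * dl, +oo[).
    by rewrite -[_ @^-1` _]setTI; apply: mS.
  by apply/seteqP; split => w; rewrite /A/= in_itv/= andbT.
move=> /markov_inequality -/(_ (expR (t * (n%:R * dl))) A mA) H.
have {H} : ((expR (t * (n%:R * dl)))%:E * P A <= (\prod_(i < n) a i)%:E)%E.
  apply: H => w.
    by apply: prodr_ge0 => i _; exact: expR_ge0.
  rewrite /A/= => Aw; rewrite -expR_sum ler_expR -mulr_sumr ler_wpM2l//.
have aP : \prod_(i < n) a i <= expR (n%:R * c).
  rewrite expRM_natl.
  rewrite -[X in _ ^+ X](card_ord n) -prodr_const; apply: ler_prod => i _.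
  rewrite (ha i).2 andbT.
  rewrite -lee_fin -(ha i).1.2; apply: integral_ge0 => w _.
  by rewrite lee_fin expR_ge0.
move=> H; have {H} := le_trans H (_ : _ <= (expR (n%:R * c))%:E)%E.
rewrite lee_fin => /(_ aP).
rewrite -lee_pdivlMl ?expR_gt0// => /le_trans; apply.
rewrite -EFinM lee_fin -expRN -expRD ler_expR le_eqVlt; apply/orP; left; apply/eqP.
by rewrite /c /t; field; rewrite gt_eqF.
Qed.

End hoeffding.

(** * Concentration of the Gram matrix of the eigenfunctions *)

Section gram.
Context dO (Omega : measurableType dO) (R : realType) (P : probability Omega R).
Context d (T : measurableType d) (PX : probability T R).
Variable X : nat -> {mfun Omega >-> T}.
Hypothesis X_iid : iid P X PX.
Variables (phi : nat -> T -> R) (c : R).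
Hypotheses (mphi : forall j, measurable_fun setT (phi j))
  (phic : forall j x, `|phi j x| <= c)
  (orth : forall j k, (\int[PX]_x (phi j x * phi k x)%:E = (j == k)%:R%:E)%E).

Lemma iid_mean (h : T -> R) i a : has_mean PX h a -> has_mean P (h \o X i) a.
Proof.
move=> [hi hm]; have mh := has_mean_measurable (conj hi hm).
have E : forall A, measurable A -> PX A = distribution P (X i) A.
  by move=> A mA; rewrite /distribution /pushforward X_iid.2.
have hi' : (distribution P (X i)).-integrable setT (EFin \o h).
  apply/integrableP; split; first exact/measurable_EFinP.
  move/integrableP: hi => [_]; rewrite (eq_measure_integral (distribution P (X i)))//.
  by move=> A mA _; exact: E.
have hP : P.-integrable setT (EFin \o (h \o X i)).
  apply/integrableP; split.
    by apply/measurable_EFinP; exact: (measurableT_comp mh (measurable_funPT (X i))).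
  move/integrableP: hi' => [_]; rewrite ge0_integral_distribution//.
  by apply: measurableT_comp => //; exact/measurable_EFinP.
split=> //.
rewrite -hm (eq_measure_integral (distribution P (X i))); last by move=> A mA _; exact: E.
rewrite integral_distribution//; exact/measurable_EFinP.
Qed.

Let g j k x := phi j x * phi k x - (j == k)%:R.

Let mg j k : measurable_fun setT (g j k).
Proof. by apply: measurable_funB => //; exact: measurable_funM. Qed.

Let b := c ^+ 2 + 1.
Let c0 : 0 <= c. Proof. exact: le_trans (normr_ge0 _) (phic 0%N point). Qed.
Let b0 : 0 < b. Proof. by rewrite ltr_wpDl// sqr_ge0. Qed.

Let pc j k x : `|phi j x * phi k x| <= c ^+ 2.
Proof. by rewrite normrM expr2 ler_pM. Qed.

Let gb j k x : `|g j k x| <= b.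
Proof.
apply: le_trans (ler_normB _ _) _; apply: lerD => //.
by rewrite normr_nat lern1 leq_b1.
Qed.

Let g_mean j k i : has_mean P (g j k \o X i) 0.
Proof.
apply: iid_mean; rewrite -(subrr (j == k)%:R); apply: has_meanB; last exact: has_mean_cst.
split => //; apply: measurable_bounded_integrable => //.
- by rewrite -ge0_fin_numE//; exact: fin_num_measure.
- exact: measurable_funM.
- exists (c ^+ 2); split; first exact: num_real.
  by move=> y cy x _; exact: le_trans (pc _ _ _) (ltW cy).
Qed.

Definition gram_bad n (dl : R) j k : set Omega :=
  [set w | n%:R * dl < `|\sum_(i < n) g j k (X i w)|].

Let mS n j k : measurable_fun setT (fun w => \sum_(i < n) g j k (X i w)).
Proof.
apply: measurable_sum => i.
exact: (measurableT_comp (mg j k) (measurable_funPT (X i))).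
Qed.

Let mbad n dl j k : measurable (gram_bad n dl j k).
Proof.
rewrite (_ : gram_bad n dl j k = (fun w => `|\sum_(i < n) g j k (X i w)|) @^-1` `]n%:R * dl, +oo[).
  rewrite -[_ @^-1` _]setTI; apply: (measurableT_comp _ (mS n j k)) => //.
by apply/seteqP; split => w; rewrite /gram_bad/= in_itv/= andbT.
Qed.

Lemma gram_bad_le n dl j k : 0 <= dl <= 2 * b ->
  (P (gram_bad n dl j k) <= (2 * expR (- (n%:R * dl ^+ 2 / (8 * b ^+ 2))))%:E)%E.
Proof.
move=> dlb; pose u := [set w | n%:R * dl <= \sum_(i < n) g j k (X i w)].
pose l := [set w | n%:R * dl <= \sum_(i < n) - g j k (X i w)].
have mge f : measurable_fun setT f -> measurable [set w : Omega | n%:R * dl <= f w].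
  move=> mf; rewrite (_ : [set w | _] = f @^-1` `[n%:R * dl, +oo[).
    by rewrite -[_ @^-1` _]setTI; exact: mf.
  by apply/seteqP; split => w /=; rewrite in_itv/= andbT.
have mu : measurable u by apply: mge.
have ml : measurable l.
  apply: mge; under eq_fun do rewrite sumrN.
  exact: measurableT_comp.
have Pu : (P u <= (expR (- (n%:R * dl ^+ 2 / (8 * b ^+ 2))))%:E)%E.
  exact: (hoeffding_upper X_iid.1 n (mg j k) (gb j k) (g_mean j k) b0 dlb).
have Pl : (P l <= (expR (- (n%:R * dl ^+ 2 / (8 * b ^+ 2))))%:E)%E.
  apply: (@hoeffding_upper _ _ _ _ _ _ _ X_iid.1 (fun x => - g j k x) _ _ n _ _ _ b0 dlb).
  - exact: measurableT_comp.
  - by move=> y; rewrite normrN.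
  - move=> i; have := has_meanZ (-1) (g_mean j k i); rewrite mulr0.
    by under eq_fun do rewrite mulN1r.
apply: (@le_trans _ _ (P (u `|` l))).
  apply: le_measure; [rewrite inE; exact: mbad|rewrite inE; exact: measurableU|].
  move=> w; rewrite /gram_bad /u /l /= => h; move: (ltW h).
  by rewrite ler_normr => /orP[?|?]; [left|right]; rewrite // sumrN.
apply: (le_trans (measureU2 _ mu ml)).
by rewrite mulr_natl mulr2n EFinD; exact: leeD.
Qed.

(** Each of the s^2 entries is an average of bounded centered variables, for
    which Hoeffding's inequality is applied with deviation 1/(2s). *)
Lemma gram_concentration n s : (0 < n)%N -> (0 < s)%N ->
  exists E : set Omega, [/\ measurable E,
    (1 - (2 * s%:R ^+ 2 * expR (- (n%:R / (32 * s%:R ^+ 2 * b ^+ 2))))%:E <= P E)%E &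
    forall w, E w -> forall j k, (j < s)%N -> (k < s)%N ->
      `|n%:R^-1 * \sum_(i < n) phi j (X i w) * phi k (X i w) - (j == k)%:R| <= (2 * s%:R)^-1].
Proof.
move=> n0 s0; pose dl : R := (2 * s%:R)^-1.
have sR : (0 : R) < s%:R by rewrite ltr0n.
have nR : (0 : R) < n%:R by rewrite ltr0n.
have dl0 : 0 <= dl by rewrite invr_ge0 mulr_ge0.
have dlb : 0 <= dl <= 2 * b.
  rewrite dl0/=; apply: (@le_trans _ _ 1).
    by rewrite invf_le1 ?mulr_gt0// -natrM ler1n muln_gt0 s0.
  by have := sqr_ge0 c; rewrite /b; lra.
set ep := expR _.
have unionP (A : nat -> set Omega) (a : R) : (forall i, measurable (A i)) ->
    (forall i, (P (A i) <= a%:E)%E) ->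
    (P (\big[setU/set0]_(i < s) A i) <= (s%:R * a)%:E)%E.
  move=> mA PA; apply: (le_trans (Boole_inequality P (fun i _ => mA i))).
  apply: (@le_trans _ _ (\sum_(i < s) a%:E)%E); first by apply: lee_sum => i _; exact: PA.
  by rewrite sumEFin sumr_const card_ord mulr_natl.
pose badj j := \big[setU/set0]_(k < s) gram_bad n dl j k.
pose bad := \big[setU/set0]_(j < s) badj j.
have mbadj j : measurable (badj j) by apply: bigsetU_measurable => k _; exact: mbad.
have mB : measurable bad by apply: bigsetU_measurable => j _; exact: mbadj.
have Pbad : (P bad <= (2 * s%:R ^+ 2 * ep)%:E)%E.
  rewrite (_ : 2 * _ * ep = s%:R * (s%:R * (2 * ep))); last by ring.
  apply: (unionP) => // j; apply: (unionP) => k; first exact: mbad.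
  apply: (le_trans (gram_bad_le _ _ _ dlb)).
  rewrite lee_fin (_ : n%:R * dl ^+ 2 / (8 * b ^+ 2) = n%:R / (32 * s%:R ^+ 2 * b ^+ 2))//.
  by rewrite /dl; field; rewrite !gt_eqF.
exists (~` bad); split; first exact: measurableC.
  by rewrite probability_setC//; apply: leeB.
move=> w nbad j k js ks; rewrite leNgt; apply/negP => h; apply: nbad.
rewrite /bad -(bigcup_mkord _ badj); exists j => //.
rewrite /badj -(bigcup_mkord _ (gram_bad n dl j)); exists k => //.
rewrite /gram_bad/= -/dl in h *.
have -> : \sum_(i < n) g j k (X i w) =
    n%:R * (n%:R^-1 * \sum_(i < n) phi j (X i w) * phi k (X i w) - (j == k)%:R).
  rewrite mulrBr mulVKf ?lt0r_neq0// /g sumrB; congr (_ - _).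
  by rewrite sumr_const card_ord mulr_natl.
by rewrite normrM gtr0_norm// ltr_pM2l.
Qed.

End gram.

(** * Conditional law of independent noise *)

Section conditional_law.
Context (R : realType) dO (Omega : measurableType dO) (P : probability Omega R).
Context d (T : measurableType d) (n : nat).
Variables (V : {mfun Omega >-> T}) (W : {mfun Omega >-> n.-tuple R}).
Variable kappa : R.-pker T ~> (n.-tuple R).
Hypotheses (VW : independent_vectors P V W) (kVW : cond_distribution P V W kappa).
Local Open Scope ereal_scope.

(** For one event, independence says that the kernel and the constant
    P (W in B) have the same integral over every event of [T]. *)
Let kappa_event B : measurable B ->
  exists N : set T, [/\ measurable N, P (V @^-1` N) = 0 &
    forall v, ~ N v -> kappa v B = P (W @^-1` B)].
Proof.
move=> mB; pose Q := distribution P V.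
have mk : measurable_fun setT (fun v => kappa v B) by exact: measurable_kernel.
have WB : P (W @^-1` B) \is a fin_num.
  by apply: fin_num_measure; exact: measurable_funPTI.
have k1 v : kappa v B <= 1 by rewrite -(@prob_kernel _ _ _ _ _ kappa v); apply: le_measure => //; rewrite inE.
have ik : Q.-integrable setT (fun v => kappa v B).
  apply/integrableP; split => //.
  apply: (@le_lt_trans _ _ (\int[Q]_v 1)); last first.
    by rewrite integral_cst//= mul1e -ge0_fin_numE//; exact: fin_num_measure.
  apply: ge0_le_integral => //.
  - exact: measurableT_comp.
  - by move=> v _; rewrite gee0_abs.
have E A : A `<=` setT -> measurable A ->
   \int[Q]_(v in A) kappa v B = \int[Q]_(v in A) (cst (P (W @^-1` B)) v).
  move=> _ mA; rewrite integral_cst//.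
  rewrite /Q ge0_integral_pushforward//; last first.
  - exact: measurable_funTS.
  have := kVW mA mB; rewrite VW// => E'.
  by rewrite [LHS](_ : _ = \int[P]_(w in V @^-1` A) kappa (V w) B)// -E' muleC.
have [N [mN N0 sN]] := integral_ae_eq measurableT ik (measurable_cst (P (W @^-1` B))) E.
exists N; split => // v nNv; apply: contrapT => h; apply: nNv; apply: sN => /=.
by move/(_ I).
Qed.


(** Boxes with rational corners are countably many and form a pi-system
    generating the sigma-algebra of tuples. *)
Let rect (q : {ffun 'I_n -> rat}) : set (n.-tuple R) :=
  [set e | forall i, (tnth e i <= ratr (q i))%R].
Let G : set (set (n.-tuple R)) := range rect.

Let mrect q : measurable (rect q).
Proof.
rewrite (_ : rect q = \bigcap_(i in [set: 'I_n]) (tnth (T := R))^~ i @^-1` [set` `]-oo, ratr (q i)]%R]).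
  apply: fin_bigcap_measurable => // i _.
  by rewrite -[_ @^-1` _]setTI; apply: measurable_tnth.
by apply/seteqP; split => e /= h i; have := h i; rewrite /= in_itv/= => // /(_ I).
Qed.

Let GI : setI_closed G.
Proof.
move=> _ _ [q _ <-] [q' _ <-]; exists [ffun i => Num.min (q i) (q' i)] => //.
apply/seteqP; split => e /=.
  move=> h; split => i; apply: le_trans (h i) _; rewrite ffunE ler_rat ge_min lexx ?orbT//.
by move=> [h h'] i; rewrite ffunE; case: (leP (q i) (q' i)).
Qed.

Let g (k : nat) : set (n.-tuple R) := rect [ffun=> k%:R].

Let g_cover : \bigcup_k g k = setT.
Proof.
apply/seteqP; split => // e _.
exists (\max_(i < n) (Num.bound `|tnth e i|%R)) => // i; rewrite ffunE ratr_nat.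
apply: le_trans (_ : _ <= (Num.bound `|tnth e i|%R)%:R)%R _.
  by apply: le_trans (ler_norm _) _; apply/ltW; apply: archi_boundP; exact: normr_ge0.
by rewrite ler_nat; apply: leq_bigmax.
Qed.

Let measurableG : @measurable _ (n.-tuple R) = <<s G >>.
Proof.
apply/seteqP; split; last first.
  apply: smallest_sub; first exact: sigma_algebra_measurable.
  by move=> _ [q _ <-]; exact: mrect.
pose T' := g_sigma_algebraType G.
have mG q : @measurable _ T' (rect q).
  by apply: sub_sigma_algebra; exists q.
have mle i (q : rat) : @measurable _ T' [set e : n.-tuple R | (tnth e i <= ratr q)%R].
  rewrite (_ : [set e : n.-tuple R | _] =
      \bigcup_k rect [ffun j => if j == i then q else k%:R]).
    by apply: bigcup_measurable => k _; exact: mG.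
  apply/seteqP; split => e /=.
    move=> ei; have : (\bigcup_k g k) e by rewrite g_cover.
    move=> [k _ ge]; exists k => // j; rewrite ffunE; case: eqP => [->//|_].
    by have := ge j; rewrite ffunE.
  by move=> [k _ /(_ i)]; rewrite ffunE eqxx.
have mt i : measurable_fun setT (fun e : T' => tnth (e : n.-tuple R) i).
  apply: (@measurability _ _ (g_sigma_algebraType G) (measurableTypeR R) setT (fun e => tnth (e : n.-tuple R) i) _ (RGenOInfty.measurableE R)).
  move=> _ [_ [x ->] <-]; rewrite setTI.
  (* only rays with rational end points are available *)
  rewrite (_ : _ @^-1` _ = \bigcup_q (if (x <= ratr q)%R
      then ~` [set e : n.-tuple R | (tnth e i <= ratr q)%R] else set0)).
    apply: bigcupT_measurable_rat => q; case: ifP => // _.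
    by apply: measurableC; exact: mle.
  apply/seteqP; split => e /=.
    rewrite in_itv/= andbT => xe; have [q] := rat_in_itvoo xe.
    rewrite in_itv/= => /andP[xq qe]; exists q => //; rewrite (ltW xq) /=.
    by apply/negP; rewrite -ltNge.
  move=> [q _]; case: ifP => // xq /= /negP; rewrite -ltNge in_itv/= andbT => h.
  exact: le_lt_trans xq h.
apply: smallest_sub; first exact: (@sigma_algebra_measurable _ T').
rewrite -bigcup_seq/= => A [i _ [B mB <-]].
by have := mt i measurableT B mB.
Qed.

(** The exceptional null set must not depend on the event: it is the union of
    those of the countably many boxes in [rect], off which the two measures
    agree by uniqueness. *)
Lemma conditional_law_ae : exists N : set T, [/\ measurable N, P (V @^-1` N) = 0 &
  forall v, ~ N v -> forall B, measurable B -> kappa v B = P (W @^-1` B)].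
Proof.
have [N NP] := choice (fun q => kappa_event (mrect q)).
have mV (A : set T) : measurable A -> measurable (V @^-1` A).
  by move=> mA; exact: measurable_funPTI.
pose N' k := if unpickle k is Some q then N q else set0.
have mN' k : measurable (N' k).
  by rewrite /N'; case: (unpickle k) => [q|//]; have [] := NP q.
exists (\bigcup_k N' k); split.
- exact: bigcupT_measurable.
- apply: measure_negligible; first by apply: mV; exact: bigcupT_measurable.
  rewrite preimage_bigcup; apply: negligible_bigcup => k.
  exists (V @^-1` N' k); split => //; first exact: mV.
  by rewrite /N'; case: (unpickle k) => [q|]; [have [] := NP q|rewrite preimage_set0 measure0].
move=> v nN B mB.
pose Q : {measure set (n.-tuple R) -> \bar R} := distribution P W.
have -> : P (W @^-1` B) = Q B by [].
apply: (@measure_unique _ R _ G g measurableG GI _ g_cover (kappa v) Q _ _ B mB).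
- by move=> k; exists [ffun=> k%:R].
- move=> _ [q _ <-]; have [_ _] := NP q; apply => Nq; apply: nN.
  by exists (pickle q) => //; rewrite /N' pickleK.
- move=> k; apply: (@le_lt_trans _ _ 1); last by rewrite ltry.
  by rewrite -(@prob_kernel _ _ _ _ _ kappa v); apply: le_measure; rewrite ?inE//; exact: mrect.
Qed.

End conditional_law.

(** * Spectrum of the kernel matrix *)

Lemma cvg_finite_sum (R : realType) (I : Type) (s : seq I) (F : I -> nat -> R) (l : I -> R) :
  (forall i, F i k @[k --> \oo] --> l i) ->
  \sum_(i <- s) F i k @[k --> \oo] --> \sum_(i <- s) l i.
Proof.
move=> Fl; elim: s => [|i s IH].
  by under eq_fun do rewrite big_nil; rewrite big_nil; exact: cvg_cst.
under eq_fun do rewrite big_cons; rewrite big_cons.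
by apply: cvgD; [exact: Fl|exact: IH].
Qed.

(** Everything is expressed in the eigenbasis of the kernel matrix: [lam i] is
    its i-th eigenvalue and [b j i] the i-th coordinate of the vector of values
    of the j-th eigenfunction, divided by the square root of the sample size.
    The hypothesis [expansion] is Mercer's expansion of the kernel matrix in
    these coordinates. *)
Section spectrum.
Variables (R : realType) (n : nat) (lam : 'I_n -> R) (b : nat -> 'I_n -> R).
Variable mu : nat -> R.
Hypotheses (lam0 : forall i, 0 <= lam i) (mu0 : forall j, 0 <= mu j).
Hypothesis expansion : forall i i',
  series (fun j => mu j * b j i * b j i') k @[k --> \oo] --> (i == i')%:R * lam i.

Lemma spectral_form_cvg (q : 'I_n -> R) :
  series (fun j => mu j * (\sum_i b j i * q i) ^+ 2) k @[k --> \oo] --> \sum_i lam i * q i ^+ 2.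
Proof.
have -> : (fun k => series (fun j => mu j * (\sum_i b j i * q i) ^+ 2) k) =
    (fun k => \sum_i \sum_i' q i * q i' * series (fun j => mu j * b j i * b j i') k).
  apply/funext => k; rewrite /series/=.
  under [RHS]eq_bigr => i _ do under eq_bigr => i' _ do rewrite mulr_sumr.
  under [RHS]eq_bigr => i _ do rewrite exchange_big/=.
  rewrite exchange_big/=; apply: eq_bigr => j _.
  rewrite expr2 mulr_suml mulr_sumr; apply: eq_bigr => i _.
  by rewrite mulr_sumr mulr_sumr; apply: eq_bigr => i' _; ring.
have -> : \sum_i lam i * q i ^+ 2 = \sum_i \sum_i' q i * q i' * ((i == i')%:R * lam i).
  apply: eq_bigr => i _; rewrite (bigD1 i)//= eqxx big1 ?addr0; first by rewrite mul1r expr2 mulrC.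
  by move=> i'; rewrite eq_sym => /negbTE ->; rewrite mul0r mulr0.
apply: cvg_finite_sum => i; apply: cvg_finite_sum => i'.
by apply: cvgM; [exact: cvg_cst|exact: expansion].
Qed.

Lemma spectral_form_le (q : 'I_n -> R) k :
  \sum_(0 <= j < k) mu j * (\sum_i b j i * q i) ^+ 2 <= \sum_i lam i * q i ^+ 2.
Proof.
have c := @spectral_form_cvg q.
rewrite -(cvg_lim _ c)//.
apply: (@nondecreasing_cvgn_le _ (series (fun j => mu j * (\sum_i b j i * q i) ^+ 2))).
  apply/nondecreasing_seqP => j; rewrite /series/= big_nat_recr//= lerDl.
  by rewrite mulr_ge0// sqr_ge0.
by apply/cvg_ex; eexists; exact: c.
Qed.

(** With K the kernel matrix and Phi_j the vector [b j], the left-hand side is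
    the sum over j of mu_j a_j, where a_j = <Phi_j, (K + h)^-1 Phi_j>.  As
    mu_j Phi_j Phi_j^T <= K, each mu_j a_j is at most 1; also a_j <= c / h.
    The first bound is used for j < s and the second one beyond. *)
Lemma effective_dimension_le (h c tau : R) s : 0 < h ->
  (forall j, \sum_i b j i ^+ 2 <= c) ->
  (forall k, \sum_(s <= j < k) mu j <= tau) ->
  \sum_i lam i / (lam i + h) <= s%:R + c / h * tau.
Proof.
move=> h0 bc mutau.
have lh i : 0 < lam i + h by rewrite ltr_wpDl.
pose a j := \sum_i b j i ^+ 2 / (lam i + h).
have a0 j : 0 <= a j by apply: sumr_ge0 => i _; rewrite divr_ge0 ?sqr_ge0// ltW.
have c1 : series (fun j => mu j * a j) k @[k --> \oo] --> \sum_i lam i / (lam i + h).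
  have -> : (fun k => series (fun j => mu j * a j) k) =
    (fun k => \sum_i series (fun j => mu j * b j i * b j i) k * (lam i + h)^-1).
    apply/funext => k; rewrite /series/=.
    under [RHS]eq_bigr do rewrite mulr_suml.
    rewrite exchange_big/=; apply: eq_bigr => j _; rewrite mulr_sumr.
    by apply: eq_bigr => i _; rewrite expr2; ring.
  apply: cvg_finite_sum => i; apply: cvgM; last exact: cvg_cst.
  by have := @expansion i i; rewrite eqxx mul1r.
have bound1 j : mu j * a j <= 1.
  (* test the inequality mu_j <Phi_j, q>^2 <= <q, K q> at q = (K + h)^-1 Phi_j *)
  pose q i := b j i / (lam i + h).
  have bq : \sum_i b j i * q i = a j.
    by apply: eq_bigr => i _; rewrite /q expr2 mulrA.
  have : mu j * a j ^+ 2 <= a j.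
    rewrite -{1}bq; apply: le_trans (_ : _ <= \sum_i lam i * q i ^+ 2) _.
      apply: le_trans (spectral_form_le q j.+1).
      rewrite big_nat_recr//= lerDr; apply: sumr_ge0 => k _.
      by rewrite mulr_ge0// sqr_ge0.
    apply: ler_sum => i _; rewrite /q.
    have -> : lam i * (b j i / (lam i + h)) ^+ 2 =
       (b j i ^+ 2 / (lam i + h)) * (lam i / (lam i + h)).
      by field; rewrite gt_eqF.
    have q1 : lam i / (lam i + h) <= 1 by rewrite ler_pdivrMr// mul1r lerDl ltW.
    by rewrite ler_piMr// divr_ge0 ?sqr_ge0// ltW.
  have := a0 j; rewrite le_eqVlt => /predU1P[<-|aj].
    by rewrite mulr0 ler01.
  by rewrite expr2 mulrA -ler_pdivlMr// divff// gt_eqF.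
have bound2 j : a j <= c / h.
  apply: le_trans (_ : _ <= (\sum_i b j i ^+ 2) / h) _.
    rewrite mulr_suml; apply: ler_sum => i _; rewrite ler_wpM2l ?sqr_ge0//.
    by rewrite lef_pV2 ?posrE// lerDr.
  by rewrite ler_wpM2r// invr_ge0 ltW.
have ch0 : 0 <= c / h by apply: le_trans (a0 0%N) (bound2 0%N).
rewrite -(cvg_lim _ c1)//; apply: limr_le.
  by apply/cvg_ex; eexists; exact: c1.
apply: nearW => k; rewrite /series/=.
have [sk|ks] := leqP s k.
  rewrite (big_cat_nat (n := s))//=; apply: lerD.
    apply: le_trans (_ : _ <= \sum_(0 <= j < s) 1) _; first exact: ler_sum.
    by rewrite sumr_const_nat subn0.
  apply: le_trans (_ : _ <= \sum_(s <= j < k) (c / h) * mu j) _.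
    by apply: ler_sum => j _; rewrite mulrC ler_wpM2r.
  by rewrite -mulr_sumr ler_wpM2l.
apply: le_trans (_ : _ <= \sum_(0 <= j < k) 1) _; first exact: ler_sum.
rewrite sumr_const_nat subn0; apply: le_trans (_ : _ <= s%:R) _.
  by rewrite ler_nat ltnW.
rewrite lerDl mulr_ge0//; have := mutau s; by rewrite big_geq.
Qed.

(** min (1, x) <= 2 x / (1 + x) reduces this to [effective_dimension_le] with
    h = 1 / eta. *)
Lemma sum_min_le (eta c tau : R) s : 0 < eta ->
  (forall j, \sum_i b j i ^+ 2 <= c) ->
  (forall k, \sum_(s <= j < k) mu j <= tau) ->
  \sum_i Num.min 1 (eta * lam i) <= 2 * (s%:R + eta * c * tau).
Proof.
move=> eta0 bc mutau.
have ie0 : 0 < eta^-1 by rewrite invr_gt0.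
have := effective_dimension_le ie0 bc mutau; rewrite invrK => H.
apply: le_trans (_ : _ <= 2 * \sum_i lam i / (lam i + eta^-1)) _; last first.
  by rewrite ler_wpM2l// [eta * c]mulrC.
rewrite mulr_sumr; apply: ler_sum => i _.
have -> : lam i / (lam i + eta^-1) = eta * lam i / (1 + eta * lam i).
  have p : 0 < 1 + eta * lam i by rewrite ltr_pwDl// mulr_ge0// ltW.
  have p2 : 0 < lam i * eta + 1 by rewrite addrC mulrC.
  by field; rewrite !gt_eqF.
have : 0 <= eta * lam i by rewrite mulr_ge0// ltW.
move: (eta * lam i) => x x0.
rewrite mulrA ler_pdivlMr; last by rewrite ltr_pwDl.
by case: (leP 1 x) => h; nra.
Qed.

(** Let w_i be the sum over j < s of b_ji^2.  Each lam_i is at least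
    mu_(s-1) w_i.  As the Gram matrix is close to the identity, w_i <= 2 and the
    w_i add up to at least s / 2, so that min (1, eta lam_i) >= w_i / 2 sums to
    at least s / 4. *)
Lemma sum_min_ge (eta : R) s : (0 < s)%N ->
  (forall j, mu j.+1 <= mu j) -> 1 <= eta * mu s.-1 ->
  (forall j k, (j < s)%N -> (k < s)%N ->
    `|\sum_i b j i * b k i - (j == k)%:R| <= (2 * s%:R)^-1) ->
  s%:R / 4 <= \sum_i Num.min 1 (eta * lam i).
Proof.
move=> s0 mudec etamu gram.
have mule j : (j < s)%N -> mu s.-1 <= mu j.
  move=> js; apply: (@nonincreasing_seqP _ _ mu).1 => //; by rewrite -ltnS prednK.
have mus0 : 0 < mu s.-1.
  rewrite lt_neqAle mu0 andbT; apply/eqP => E.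
  by move: etamu; rewrite -E mulr0 ler10.
have eta0 : 0 <= eta.
  by rewrite -(pmulr_lge0 _ mus0) (le_trans ler01 etamu).
pose w i := \sum_(0 <= j < s) b j i ^+ 2.
have s1 : (1 : R) <= s%:R by rewrite ler1n.
have sgt0 : (0 : R) < s%:R by rewrite ltr0n.
have w0 i : 0 <= w i by apply: sumr_ge0 => j _; exact: sqr_ge0.
have lamw i : mu s.-1 * w i <= lam i.
  have := spectral_form_le (fun i' => (i' == i)%:R) s.
  rewrite [leRHS](bigD1 i)//= eqxx expr1n mulr1 [X in _ + X]big1 ?addr0; last first.
    by move=> i' /negbTE ->; rewrite expr0n mulr0.
  apply: le_trans; rewrite mulr_sumr; apply: ler_sum_nat => j /= js.
  rewrite (bigD1 i)//= eqxx mulr1 big1 ?addr0; last first.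
    by move=> i' /negbTE ->; rewrite mulr0.
  by rewrite ler_wpM2r ?sqr_ge0// mule.
have w2 i : w i <= 2.
  (* w_i is the i-th entry of the combination r of the Phi_j with coefficients
     b_ji, whose squared norm is at most 3/2 w_i; hence w_i^2 <= 3/2 w_i *)
  pose r i' := \sum_(0 <= j < s) b j i * b j i'.
  have rr : \sum_i' r i' ^+ 2 = \sum_(0 <= j < s) \sum_(0 <= k < s)
      (b j i * b k i) * \sum_i' b j i' * b k i'.
    under eq_bigr do rewrite expr2 mulr_suml.
    rewrite exchange_big/=; apply: eq_bigr => j _.
    under eq_bigr do rewrite mulr_sumr.
    rewrite exchange_big/=; apply: eq_bigr => k _.
    by rewrite mulr_sumr; apply: eq_bigr => i' _; ring.
  have h1 : w i ^+ 2 <= \sum_i' r i' ^+ 2.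
    rewrite (bigD1 i)//= (_ : w i = r i).
      by rewrite lerDl; apply: sumr_ge0 => i' _; exact: sqr_ge0.
    by apply: eq_bigr => j _; rewrite expr2.
  have h2 : \sum_i' r i' ^+ 2 <= \sum_(0 <= j < s) \sum_(0 <= k < s)
     (b j i * b k i * (j == k)%:R + (b j i ^+ 2 + b k i ^+ 2) / 2 * (2 * s%:R)^-1).
    rewrite rr; apply: ler_sum_nat => j /= js; apply: ler_sum_nat => k /= ks.
    have := gram j k js ks; rewrite ler_norml => /andP[g1 g2].
    have e0 : 0 <= (2 * s%:R)^-1 :> R by rewrite invr_ge0 mulr_ge0.
    set e := (2 * s%:R)^-1 in g1 g2 e0 *.
    set g := \sum_i' _ in g1 g2 *.
    have := sqr_ge0 (b j i - b k i); have := sqr_ge0 (b j i + b k i).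
    move: (b j i) (b k i) => x y; rewrite -subr_ge0 => p1 p2.
    rewrite -subr_ge0; have -> : x * y * (j == k)%:R + (x ^+ 2 + y ^+ 2) / 2 * e - x * y * g =
      (x - y) ^+ 2 / 4 * (e - (j == k)%:R + g + 0) + (x + y) ^+ 2 / 4 * (e + (j == k)%:R - g) by field.
    rewrite addr0 subr0; apply: addr_ge0; apply: mulr_ge0; rewrite ?divr_ge0 ?sqr_ge0//; lra.
  have h3 : \sum_(0 <= j < s) \sum_(0 <= k < s)
     (b j i * b k i * (j == k)%:R + (b j i ^+ 2 + b k i ^+ 2) / 2 * (2 * s%:R)^-1)
     = w i + w i / 2.
    under eq_bigr do rewrite big_split/=.
    rewrite big_split/=; congr (_ + _).
      rewrite /w !big_mkord; apply: eq_bigr => j _.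
      rewrite big_mkord (bigD1 j)//= eqxx mulr1 -expr2 big1 ?addr0// => k kj.
      by rewrite eq_sym -val_eqE/= in kj; rewrite (negbTE kj) mulr0.
    under eq_bigr => j _.
      rewrite -mulr_suml -mulr_suml big_split/= sumr_const_nat subn0 -/(w i).
      over.
    rewrite -mulr_suml -mulr_suml big_split/= sumr_const_nat subn0 !sumrMnl.
    have key (W : R) : (W *+ s + W *+ s) / 2 / (2 * s%:R) = W / 2.
      by rewrite -mulrnDl -[(W + W) *+ s]mulr_natr; field; rewrite gt_eqF.
    exact: key.
  have : w i ^+ 2 <= w i + w i / 2 by rewrite -h3; exact: le_trans h1 h2.
  have := w0 i; nra.
have wsum : s%:R / 2 <= \sum_i w i.
  rewrite exchange_big/=.
  apply: le_trans (_ : _ <= \sum_(0 <= j < s) (2^-1 : R)) _.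
    by rewrite sumr_const_nat subn0 mulr_natl.
  apply: ler_sum_nat => j /= js.
  have := gram j j js js; rewrite eqxx ler_norml => /andP[+ _].
  have -> : \sum_i b j i * b j i = \sum_i b j i ^+ 2.
    by apply: eq_bigr => i _; rewrite expr2.
  have : (2 * s%:R)^-1 <= (2^-1 : R).
    by rewrite lef_pV2 ?posrE ?mulr_gt0// ler_peMr.
  by move: (2 * s%:R)^-1 (\sum_i _) => e t /=; rewrite -[true%:R]/(1 : R); lra.
apply: le_trans (_ : _ <= \sum_i w i / 2) _.
  by rewrite -mulr_suml; lra.
apply: ler_sum => i _; rewrite le_min.
have lw : w i <= eta * lam i.
  apply: le_trans (_ : _ <= eta * (mu s.-1 * w i)) _; last exact: ler_wpM2l.
  by rewrite mulrA ler_peMl.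
have := w0 i; have := w2 i => h1 h2.
by apply/andP; split; lra.
Qed.

End spectrum.

(** * Eigenfunctions in the eigenbasis of the kernel matrix *)

Section sampled_kernel.
Variables (R : realType) (T : Type) (K : T -> T -> R) (mu : nat -> R) (phi : nat -> T -> R).
Hypothesis expansion : forall x x',
  series (fun i => mu i * phi i x * phi i x') k @[k --> \oo] --> K x x'.
Variables (n : nat) (x : n.-tuple T) (U : 'M[R]_n) (lam : nat -> R).
Hypothesis KU : eigendecomposition (kernel_mx K x) U lam.

Definition eigen_coord (j : nat) (i : 'I_n) : R :=
  Num.sqrt n%:R^-1 * (U^T *m eval_at (phi j) x) i 0.

Lemma eigen_coord_dot j k :
  \sum_i eigen_coord j i * eigen_coord k i =
  n%:R^-1 * \sum_(i < n) phi j (tnth x i) * phi k (tnth x i).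
Proof.
have s2 : Num.sqrt n%:R^-1 * Num.sqrt n%:R^-1 = n%:R^-1 :> R.
  by rewrite -expr2 sqr_sqrtr// invr_ge0.
have -> : \sum_(i < n) phi j (tnth x i) * phi k (tnth x i) =
   ((eval_at (phi j) x)^T *m (eval_at (phi k) x)) 0 0.
  by rewrite mxE; apply: eq_bigr => i _; rewrite !mxE.
have -> : (eval_at (phi j) x)^T *m (eval_at (phi k) x) =
   (U^T *m eval_at (phi j) x)^T *m (U^T *m eval_at (phi k) x).
  by rewrite trmx_mul trmxK -mulmxA [U *m _]mulmxA (eigen_orth KU) mul1mx.
rewrite [X in _ * X]mxE mulr_sumr; apply: eq_bigr => i _.
by rewrite /eigen_coord [X in _ = _ * (X * _)]mxE; move: s2; set q := Num.sqrt _ => <-; ring.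
Qed.

Lemma eigen_coord_expansion (i i' : 'I_n) :
  series (fun j => mu j * eigen_coord j i * eigen_coord j i') k @[k --> \oo]
    --> (i == i')%:R * lam i.
Proof.
have s2 : Num.sqrt n%:R^-1 * Num.sqrt n%:R^-1 = n%:R^-1 :> R.
  by rewrite -expr2 sqr_sqrtr// invr_ge0.
have -> : (i == i')%:R * lam i = \sum_a \sum_a' (U a i * U a' i' * n%:R^-1) * K (tnth x a) (tnth x a').
  have -> : (i == i')%:R * lam i = (U^T *m (kernel_mx K x *m U)) i i'.
    rewrite (eigen_eq KU) -!mulmxA (mulmx1C (eigen_orth KU)) mulmx1.
    rewrite mulmxA (mulmx1C (eigen_orth KU)) mul1mx !mxE mulr_natl.
    by case: eqP => // _; rewrite mulr0n mulr0n.
  rewrite mxE; apply: eq_bigr => a _; rewrite !mxE mulr_sumr; apply: eq_bigr => a' _.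
  by rewrite !mxE; ring.
have -> : (fun k => series (fun j => mu j * eigen_coord j i * eigen_coord j i') k) =
   (fun k => \sum_a \sum_a' (U a i * U a' i' * n%:R^-1) *
      series (fun j => mu j * phi j (tnth x a) * phi j (tnth x a')) k).
  apply/funext => k; rewrite /series/=.
  under [RHS]eq_bigr => a _ do under eq_bigr => a' _ do rewrite mulr_sumr.
  under [RHS]eq_bigr => a _ do rewrite exchange_big/=.
  rewrite exchange_big/=; apply: eq_bigr => j _.
  rewrite /eigen_coord !mxE; move: s2; set q := Num.sqrt _ => <-.
  have -> : forall S X Y : R, mu j * (S * X) * (S * Y) = mu j * (S * S) * (X * Y) by move=> *; ring.
  rewrite mulr_suml mulr_sumr; apply: eq_bigr => a _.
  by rewrite mulr_sumr mulr_sumr; apply: eq_bigr => a' _; rewrite !mxE; ring.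
apply: cvg_finite_sum => a; apply: cvg_finite_sum => a'.
by apply: cvgM; [exact: cvg_cst|exact: expansion].
Qed.

End sampled_kernel.

(** * Gradient descent in the eigenbasis *)

Section orthogonal_coordinates.
Variables (R : realType) (n : nat) (U : 'M[R]_n).
Hypothesis UU : U *m U^T = 1%:M.

Lemma orth_trmx : U^T *m U = 1%:M. Proof. exact: mulmx1C. Qed.

Lemma sum_sqr_mxE (v : 'cV[R]_n) : \sum_i v i 0 ^+ 2 = (v^T *m v) 0 0.
Proof. by rewrite mxE; apply: eq_bigr => i _; rewrite mxE expr2. Qed.

Lemma sum_sqr_orth_tr (v : 'cV[R]_n) : \sum_i (U^T *m v) i 0 ^+ 2 = \sum_i v i 0 ^+ 2.
Proof. by rewrite !sum_sqr_mxE trmx_mul trmxK -mulmxA [U *m _]mulmxA UU mul1mx. Qed.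

Let D (g : 'I_n -> R) := diag_mx (\row_i g i).
Definition orth_diag (g : 'I_n -> R) : 'M[R]_n := U *m D g *m U^T.

Lemma orth_diag_sym g : (orth_diag g)^T = orth_diag g.
Proof. by rewrite /orth_diag !trmx_mul trmxK tr_diag_mx mulmxA. Qed.

Lemma orth_diagM g h : orth_diag g *m orth_diag h = orth_diag (fun i => g i * h i).
Proof.
rewrite /orth_diag -!mulmxA [U^T *m (U *m _)]mulmxA orth_trmx mul1mx.
rewrite [D g *m (D h *m _)]mulmxA mulmx_diag; congr (_ *m (diag_mx _ *m _)).
by apply/rowP => i; rewrite !mxE.
Qed.

Lemma orth_diag_tr g : \tr (orth_diag g) = \sum_i g i.
Proof.
rewrite /orth_diag mxtrace_mulC mulmxA orth_trmx mul1mx mxtrace_diag.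
by apply: eq_bigr => i _; rewrite mxE.
Qed.

Lemma orth_diag_coord g (v : 'cV[R]_n) i : (U^T *m (orth_diag g *m v)) i 0 = g i * (U^T *m v) i 0.
Proof.
rewrite /orth_diag -!mulmxA [U^T *m (U *m _)]mulmxA orth_trmx mul1mx.
by rewrite mul_diag_mx !mxE.
Qed.

Lemma orth_diag_mul_sqr g (v : 'cV[R]_n) :
  \sum_i (orth_diag g *m v) i 0 ^+ 2 = \sum_i g i ^+ 2 * (U^T *m v) i 0 ^+ 2.
Proof.
rewrite -sum_sqr_orth_tr; apply: eq_bigr => i _.
by rewrite orth_diag_coord exprMn.
Qed.

Lemma orth_diag_entries_sqr g : \sum_i \sum_j orth_diag g i j ^+ 2 = \sum_i g i ^+ 2.
Proof.
have -> : \sum_i g i ^+ 2 = \tr (orth_diag g *m orth_diag g).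
  by rewrite orth_diagM orth_diag_tr; apply: eq_bigr => i _; rewrite expr2.
apply: eq_bigr => i _; rewrite mxE; apply: eq_bigr => j _.
by have := congr1 (fun M : 'M[R]_n => M j i) (orth_diag_sym g); rewrite mxE => <-; rewrite expr2.
Qed.

Lemma orth_diag_form g (v : 'cV[R]_n) :
  \sum_j \sum_k orth_diag g j k * (v j 0 * v k 0) = \sum_i g i * (U^T *m v) i 0 ^+ 2.
Proof.
transitivity ((v^T *m (orth_diag g *m v)) 0 0).
  rewrite mxE; apply: eq_bigr => j _; rewrite !mxE mulr_sumr.
  by apply: eq_bigr => k _; ring.
rewrite /orth_diag -!mulmxA [v^T *m (U *m _)]mulmxA.
rewrite (_ : v^T *m U = (U^T *m v)^T); last by rewrite trmx_mul trmxK.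
rewrite mul_diag_mx mxE; apply: eq_bigr => i _; rewrite !mxE; ring.
Qed.

End orthogonal_coordinates.

Section gradient_descent.
Variables (R : realType) (n : nat) (K U : 'M[R]_n) (lam alpha : nat -> R).
Hypothesis KU : eigendecomposition K U lam.

(** The i-th diagonal entry of the shrinkage matrix. *)
Definition shrink (t i : nat) : R := \prod_(0 <= tau < t) (1 - alpha tau * lam i).

Lemma shrinkage_diag t : shrinkage n alpha lam t = diag_mx (\row_i shrink t (val i)).
Proof.
rewrite /shrinkage; elim: t => [|t IH].
  rewrite big_nil; apply/matrixP => i j.
  by rewrite !mxE /shrink big_nil.
rewrite big_nat_recr//= IH -[_ * _]/(_ *m _) /lam_mx.
rewrite -scalemx1 scale1r -diag_const_mx.
rewrite -linearZ/= -linearB/= mulmx_diag; congr diag_mx; apply/rowP => i.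
by rewrite !mxE /shrink big_nat_recr.
Qed.

Lemma one_minus_shrinkage t :
  1%:M - shrinkage n alpha lam t = diag_mx (\row_i (1 - shrink t (val i))).
Proof.
rewrite shrinkage_diag -diag_const_mx -linearB/=; congr diag_mx.
by apply/rowP => i; rewrite !mxE.
Qed.

Lemma tr_diag_exp (g : 'I_n -> R) k :
  \tr ((diag_mx (\row_i g i) : 'M[R]_n) ^+ k) = \sum_i g i ^+ k.
Proof.
have -> : (diag_mx (\row_i g i) : 'M[R]_n) ^+ k = diag_mx (\row_i (g i ^+ k)).
  elim: k => [|k IH].
    by apply/matrixP => i j; rewrite expr0 !mxE expr0.
  rewrite exprS IH -[_ * _]/(_ *m _) mulmx_diag; congr diag_mx; apply/rowP => i.
  by rewrite !mxE exprS.
by rewrite mxtrace_diag; apply: eq_bigr => i _; rewrite mxE.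
Qed.

Lemma null_meanE t :
  null_mean n alpha lam t = n%:R^-1 * \sum_(i < n) (1 - shrink t i) ^+ 2.
Proof. by rewrite /null_mean one_minus_shrinkage tr_diag_exp. Qed.

Lemma null_sdE t :
  null_sd n alpha lam t = Num.sqrt (2 / n%:R ^+ 2 * \sum_(i < n) (1 - shrink t i) ^+ 4).
Proof. by rewrite /null_sd one_minus_shrinkage tr_diag_exp. Qed.

(** The residual f_t - y has coordinates - S_i y_i in the eigenbasis, and a step
    of gradient descent multiplies it by 1 - alpha_t lam_i. *)
Lemma grad_descentE y t :
  grad_descent alpha K y t = orth_diag U (fun i => 1 - shrink t i) *m y.
Proof.
have UU := eigen_orth KU.
have KE : K = orth_diag U (fun i => lam i) by rewrite {1}(eigen_eq KU).
elim: t => [|t IH] /=.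
  rewrite /orth_diag (_ : diag_mx _ = 0) ?mulmx0 ?mul0mx//.
  by apply/matrixP => i j; rewrite !mxE /shrink big_nil subrr mul0rn.
have yE : y = orth_diag U (fun=> 1) *m y.
  rewrite /orth_diag (_ : diag_mx _ = 1%:M) ?mulmx1 ?UU ?mul1mx//.
  by rewrite -diag_const_mx; congr diag_mx; apply/rowP => i; rewrite !mxE.
have lin (a b : 'I_n -> R) c : orth_diag U a *m y - c *: (orth_diag U b *m y)
    = orth_diag U (fun i => a i - c * b i) *m y.
  rewrite scalemxAl -mulmxBl; congr (_ *m _).
  rewrite /orth_diag scalemxAl scalemxAr -mulmxBl -mulmxBr; congr (_ *m _ *m _).
  by rewrite -linearZ -linearB; congr diag_mx; apply/rowP => i; rewrite !mxE.
have E1 : orth_diag U (fun i => 1 - shrink t i) *m y - y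
    = orth_diag U (fun i => 1 - shrink t i - 1 * 1) *m y.
  by rewrite {2}yE -[X in _ - X]scale1r lin.
rewrite IH E1 KE mulmxA orth_diagM// lin.
congr (orth_diag U _ *m y); apply/funext => i.
rewrite /shrink big_nat_recr//=; ring.
Qed.

Lemma test_statE y t : test_stat alpha K y t =
  n%:R^-1 * \sum_(i < n) (1 - shrink t i) ^+ 2 * (U^T *m y) i 0 ^+ 2.
Proof.
rewrite /test_stat /emp_norm sqr_sqrtr; last first.
  by rewrite mulr_ge0 ?invr_ge0//; apply: sumr_ge0 => i _; exact: sqr_ge0.
by rewrite grad_descentE (orth_diag_mul_sqr (eigen_orth KU)).
Qed.

Lemma test_stat_noise (v e : 'cV[R]_n) t :
  let B := orth_diag U (fun i => (1 - shrink t i) ^+ 2) in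
  (0 < n)%N ->
  n%:R * (test_stat alpha K (v + e) t - null_mean n alpha lam t) =
  \sum_(i < n) (1 - shrink t i) ^+ 2 * (U^T *m v) i 0 ^+ 2 +
  (\sum_i \sum_j B i j * (e i 0 * e j 0 - (i == j)%:R) + \sum_i (2 * (B *m v) i 0) * e i 0).
Proof.
move=> B n0; rewrite test_statE null_meanE -mulrBr mulrA mulfV ?mul1r ?pnatr_eq0 -?lt0n//.
rewrite -!orth_diag_form -/B.
have -> : \sum_(i < n) (1 - shrink t i) ^+ 2 = \sum_i \sum_j B i j * (i == j)%:R.
  rewrite -(orth_diag_tr (eigen_orth KU)) -/B; apply: eq_bigr => i _.
  rewrite (bigD1 i)//= eqxx mulr1 big1 ?addr0// => j; rewrite eq_sym => /negbTE ->.
  by rewrite mulr0.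
have -> : \sum_i 2 * (B *m v) i 0 * e i 0 =
   \sum_i \sum_j (B i j * (e i 0 * v j 0) + B i j * (v i 0 * e j 0)).
  under [RHS]eq_bigr do rewrite big_split/=.
  rewrite big_split/= [X in _ = _ + X]exchange_big/= -big_split/=.
  apply: eq_bigr => i _; rewrite mxE mulr_sumr mulr_suml -big_split/=.
  apply: eq_bigr => j _.
  have -> : B j i = B i j.
    have := congr1 (fun M : 'M[R]_n => M i j) (orth_diag_sym U (fun i => (1 - shrink t i) ^+ 2)).
    by rewrite mxE.
  by ring.
rewrite -sumrB -!big_split/=; apply: eq_bigr => i _.
rewrite -sumrB -!big_split/=; apply: eq_bigr => j _.
by rewrite !mxE; ring.
Qed.

End gradient_descent.

Section shrink_bounds.
Variables (R : realType) (lam alpha : nat -> R).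
Hypothesis (alpha0 : forall t, 0 <= alpha t).

Lemma total_step_ge0 t : 0 <= total_step alpha t.
Proof. by apply: sumr_ge0. Qed.

(** The last inequality, a polynomial version of S <= exp (- eta lam), is
    preserved by a step since (1 - a) (1 + h + a) <= 1 + h. *)
Lemma shrink_bounds i t : 0 <= lam i -> (forall t, alpha t * lam i <= 1) ->
  [/\ 0 <= shrink lam alpha t i, shrink lam alpha t i <= 1,
    1 - shrink lam alpha t i <= total_step alpha t * lam i &
    shrink lam alpha t i * (1 + total_step alpha t * lam i) <= 1].
Proof.
move=> l0 al; elim: t => [|t [s0 s1 s2 s3]].
  by rewrite /shrink /total_step !big_nil; split; lra.
have := al t; have : 0 <= alpha t * lam i by rewrite mulr_ge0.
have : 0 <= total_step alpha t * lam i by rewrite mulr_ge0// total_step_ge0.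
rewrite /shrink /total_step !big_nat_recr//= -/(shrink _ _ _ _) -/(total_step _ _) mulrDl.
move: (shrink _ _ _ _) (alpha t * lam i) (total_step alpha t * lam i) s0 s1 s2 s3 => s a h.
by move=> s0 s1 s2 s3 h0 a0 a1; split; nra.
Qed.

End shrink_bounds.

(** * Bias of gradient descent on the RKHS ball *)

Section rkhs.
Variables (R : realType) (T : Type) (D : set T) (H : set (T -> R)).
Variables (ip : (T -> R) -> (T -> R) -> R) (K : T -> T -> R).
Hypothesis HK : is_rkhs D H ip K.

Lemma rkhs_ip0 h : H h -> ip (fun=> 0) h = 0.
Proof.
move=> Hh; have H0 := rkhs_zero HK.
have := rkhs_ip_lin HK (-1) H0 H0 Hh.
rewrite (_ : (fun x => -1 * 0 + 0) = (fun=> 0)); last by apply/funext => x; rewrite mulr0 addr0.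
by move=> ->; rewrite mulN1r addNr.
Qed.

Lemma rkhs_sum (I : Type) (s : seq I) (a : I -> R) (F : I -> T -> R) :
  (forall i, H (F i)) ->
  H (fun y => \sum_(i <- s) a i * F i y) /\
  forall h, H h -> ip (fun y => \sum_(i <- s) a i * F i y) h = \sum_(i <- s) a i * ip (F i) h.
Proof.
move=> HF; elim: s => [|i s [IH1 IH2]].
  rewrite (_ : (fun y => _) = fun=> 0); last by apply/funext => y; rewrite big_nil.
  split; first exact: (rkhs_zero HK).
  by move=> h Hh; rewrite big_nil rkhs_ip0.
rewrite (_ : (fun y => _) = fun y => a i * F i y + \sum_(i <- s) a i * F i y); last first.
  by apply/funext => y; rewrite big_cons.
split; first exact: (rkhs_lin HK).
by move=> h Hh; rewrite big_cons (rkhs_ip_lin HK)// IH2.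
Qed.

Lemma rkhs_cauchy_schwarz f g : H f -> H g -> ip f g ^+ 2 <= ip f f * ip g g.
Proof.
move=> Hf Hg; have ff0 := rkhs_ip_ge0 HK Hf.
have [E|ffN0] := eqVneq (ip f f) 0.
  by rewrite (rkhs_ip_eq0 HK Hf E) !rkhs_ip0 ?expr0n ?mul0r//; exact: (rkhs_zero HK).
have ffp : 0 < ip f f by rewrite lt_neqAle eq_sym ffN0.
pose t := - ip f g / ip f f.
have Hh := rkhs_lin HK t Hf Hg.
have := rkhs_ip_ge0 HK Hh.
rewrite (rkhs_ip_lin HK)// (rkhs_ipC HK Hf Hh) (rkhs_ipC HK Hg Hh).
rewrite !(rkhs_ip_lin HK)// (rkhs_ipC HK Hg Hf).
have -> : t * (t * ip f f + ip f g) + (t * ip f g + ip g g) = ip g g - ip f g ^+ 2 / ip f f.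
  by rewrite /t; field.
by rewrite subr_ge0 ler_pdivrMr// mulrC.
Qed.

(** The reproducing property writes the combination of values as the inner
    product of f with the same combination of kernel sections, and
    Cauchy-Schwarz applies. *)
Lemma rkhs_eval_sum_le n (x : 'I_n -> T) (a : 'I_n -> R) f : H f ->
  (\sum_i a i * f (x i)) ^+ 2 <= ip f f * \sum_i \sum_j a i * a j * K (x i) (x j).
Proof.
move=> Hf.
have Hk i := rkhs_kernel HK (x i).
have [Hg ipg] := rkhs_sum (index_enum 'I_n) a Hk.
set g := fun y => _ in Hg ipg.
have -> : \sum_i a i * f (x i) = ip f g.
  rewrite (rkhs_ipC HK)// ipg//; apply: eq_bigr => i _; congr (_ * _).
  by rewrite (rkhs_reproducing HK _ Hf) (rkhs_ipC HK).
apply: le_trans (rkhs_cauchy_schwarz Hf Hg) _.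
rewrite ler_wpM2l ?(rkhs_ip_ge0 HK)// {1}/g ipg// le_eqVlt; apply/orP; left; apply/eqP.
apply: eq_bigr => i _; rewrite (rkhs_ipC HK)// -(rkhs_reproducing HK _ Hg) /g mulr_sumr.
by apply: eq_bigr => j _; rewrite mulrA.
Qed.

(** [rkhs_eval_sum_le] is applied to the vector a = U S^2 U^T v.  Then <a, v> is
    the left-hand side bt, while the kernel form at a is n times the sum of
    lam_i S_i^4 v_i^2, at most n bt / eta; so bt^2 <= ip f f * (n bt / eta). *)
Lemma rkhs_bias n (x : n.-tuple T) (U : 'M[R]_n) (lam : nat -> R) (S : 'I_n -> R) (eta : R) f :
  eigendecomposition (kernel_mx K x) U lam -> (0 < n)%N -> 0 < eta ->
  (forall i : 'I_n, lam i * S i ^+ 2 <= eta^-1) -> H f ->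
  \sum_i S i ^+ 2 * (U^T *m eval_at f x) i 0 ^+ 2 <= n%:R * ip f f / eta.
Proof.
move=> KU n0 eta0 lamS Hf; have UU := eigen_orth KU.
set v := eval_at f x; set bt := \sum_i _.
pose M := orth_diag U (fun i => S i ^+ 2).
pose a i := (M *m v) i 0.
have nR : (0 : R) < n%:R by rewrite ltr0n.
have bt0 : 0 <= bt by apply: sumr_ge0 => i _; rewrite mulr_ge0// sqr_ge0.
have E1 : \sum_i a i * f (tnth x i) = bt.
  rewrite /bt -orth_diag_form; apply: eq_bigr => i _; rewrite /a mxE mulr_suml.
  by apply: eq_bigr => j _; rewrite !mxE; ring.
have E2 : \sum_i \sum_j a i * a j * K (tnth x i) (tnth x j) <= n%:R * (bt / eta).
  have -> : \sum_i \sum_j a i * a j * K (tnth x i) (tnth x j) =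
     n%:R * \sum_i \sum_j orth_diag U (fun i : 'I_n => lam i) i j * ((M *m v) i 0 * (M *m v) j 0).
    have -> : orth_diag U (fun i : 'I_n => lam i) = kernel_mx K x by rewrite (eigen_eq KU).
    rewrite mulr_sumr; apply: eq_bigr => i _; rewrite mulr_sumr; apply: eq_bigr => j _.
    rewrite [kernel_mx _ _ _ _]mxE /a; field; by rewrite gt_eqF.
  rewrite orth_diag_form ler_pM2l// mulr_suml; apply: ler_sum => i _.
  rewrite (orth_diag_coord UU) exprMn.
  have -> : lam i * ((S i ^+ 2) ^+ 2 * (U^T *m v) i 0 ^+ 2) =
    (S i ^+ 2 * (U^T *m v) i 0 ^+ 2) * (lam i * S i ^+ 2) by ring.
  by rewrite ler_wpM2l// mulr_ge0// sqr_ge0.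
have := rkhs_eval_sum_le (tnth x) a Hf; rewrite E1 => H1.
have ff0 := rkhs_ip_ge0 HK Hf.
have : bt ^+ 2 <= bt * (n%:R * ip f f / eta).
  apply: (le_trans H1); apply: (le_trans (ler_wpM2l ff0 E2)).
  by rewrite le_eqVlt; apply/orP; left; apply/eqP; ring.
move: bt0; rewrite le_eqVlt => /predU1P[<- _|btp].
  by rewrite divr_ge0 ?mulr_ge0// ltW.
by rewrite expr2 ler_pM2l.
Qed.

End rkhs.

(** * Rates *)

Section rates.
Variable R : realType.

Lemma half_le_truncn (x : R) : 1 <= x ->
  [/\ (0 < Num.truncn x)%N, (Num.truncn x)%:R <= x & x / 2 <= (Num.truncn x)%:R].
Proof.
move=> x1; have x0 : 0 <= x by apply: le_trans x1.
have /andP[h1 h2] := truncn_itv x0.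
have s0 : (0 < Num.truncn x)%N by rewrite truncn_gt0.
split => //; have : (1 : R) <= (Num.truncn x)%:R by rewrite ler1n.
by move: h2; rewrite -natr1; lra.
Qed.

(** 1 / (j + 1)^2 <= 1 / j - 1 / (j + 1) telescopes. *)
Lemma sum_inv_square_le s k : (0 < s)%N ->
  \sum_(s <= j < k) (j.+1%:R ^+ 2)^-1 <= s%:R^-1 :> R.
Proof.
move=> s0; have [sk|ks] := leqP s k; last by rewrite big_geq ?invr_ge0// ltnW.
have k0 : (0 < k)%N by exact: leq_trans s0 sk.
have sR : (0 : R) < s%:R by rewrite ltr0n.
suff : \sum_(s <= j < k) (j.+1%:R ^+ 2)^-1 <= s%:R^-1 - k%:R^-1 :> R.
  by move/le_trans; apply; rewrite lerBlDr lerDl invr_ge0.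
have := telescope_sumr (fun j => - (j%:R^-1 : R)) sk.
rewrite opprK [_ + s%:R^-1]addrC => <-; apply: ler_sum_nat => j /andP[sj _].
have j0 : (0 : R) < j%:R by rewrite ltr0n (leq_trans s0).
rewrite opprK [X in _ <= X]addrC -natr1; have j1 : (0 : R) < j%:R + 1 by rewrite ltr_wpDl// ltW.
have -> : j%:R^-1 - (j%:R + 1)^-1 = (j%:R * (j%:R + 1))^-1 :> R.
  by field; rewrite !gt_eqF.
by rewrite lef_pV2 ?posrE ?mulr_gt0 ?exprn_gt0// expr2 ler_wpM2r ?ltW// ltrDl.
Qed.

(** A power j^(2 - 2m), largest at the start of the tail, is split off so that
    only the sum of the inverse squares remains. *)
Lemma poly_decay_tail (m b : R) (mu : nat -> R) s k : 1 <= m -> 0 < b ->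
  (forall i, mu i <= b * i.+1%:R `^ (- (2 * m))) -> (0 < s)%N ->
  \sum_(s <= j < k) mu j <= b * s%:R `^ (1 - 2 * m).
Proof.
move=> m1 b0 mub s0; have sR : (0 : R) < s%:R by rewrite ltr0n.
apply: (@le_trans _ _ (\sum_(s <= j < k) (b * s%:R `^ (2 - 2 * m)) * (j.+1%:R ^+ 2)^-1)).
  apply: ler_sum_nat => j /andP[sj _]; apply: le_trans (mub j) _.
  rewrite -mulrA ler_wpM2l ?(ltW b0)//.
  have j0 : (0 : R) < j.+1%:R by rewrite ltr0n.
  have -> : j.+1%:R `^ (- (2 * m)) = j.+1%:R `^ (2 - 2 * m) * (j.+1%:R ^+ 2)^-1 :> R.
    rewrite -powR_mulrn ?ltW// -powRN -powRD; last by apply/implyP => _; rewrite gt_eqF.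
    by congr (_ `^ _); ring.
  rewrite ler_wpM2r ?invr_ge0 ?exprn_ge0//.
  have -> : 2 - 2 * m = - (2 * m - 2) by ring.
  rewrite !powRN lef_pV2 ?posrE ?powR_gt0//; apply: ge0_ler_powR.
  - by lra.
  - by rewrite nnegrE ltW.
  - by rewrite nnegrE ltW.
  - by rewrite ler_nat ltnW.
rewrite -mulr_sumr; apply: (@le_trans _ _ (b * s%:R `^ (2 - 2 * m) * s%:R^-1)).
  by rewrite ler_wpM2l ?sum_inv_square_le// mulr_ge0 ?powR_ge0// ltW.
rewrite -mulrA ler_wpM2l ?(ltW b0)// -powR_inv1 ?(ltW sR)// -powRD.
  by rewrite le_eqVlt; apply/orP; left; apply/eqP; congr (_ `^ _); ring.
by apply/implyP => _; rewrite gt_eqF.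
Qed.

Section scales.
Variables (m : R) (n : nat).
Hypotheses (hm : 3 / 2 < m) (n0 : (0 < n)%N).
(** The common scale: the sample size is rate^(4m+1), the total step size at the
    stopping time of order rate^(4m), the effective dimension there of order
    rate^2, and the separation rate in the empirical norm is rate^(-2m). *)
Definition rate : R := n%:R `^ (4 * m + 1)^-1.

Let m1 : 0 < 4 * m + 1. Proof. by move: hm; lra. Qed.
Let nR : (0 : R) < n%:R. Proof. by rewrite ltr0n. Qed.

Lemma rate_ge1 : 1 <= rate.
Proof.
have n1 : (1 : R) <= n%:R by rewrite ler1n.
have := ler_powR n1 (_ : 0 <= (4 * m + 1)^-1); rewrite powRr0; apply.
by rewrite invr_ge0 ltW.
Qed.

Lemma powR_rate (p q : R) : p = q / (4 * m + 1) -> n%:R `^ p = rate `^ q.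
Proof. by move=> ->; rewrite /rate -powRrM mulrC. Qed.

Lemma rate_powR1 : n%:R = rate `^ (4 * m) * rate.
Proof.
have r0 : 0 < rate by exact: lt_le_trans ltr01 rate_ge1.
rewrite -[X in _ * X]powRr1 ?ltW// -powRD; last by apply/implyP => _; rewrite gt_eqF.
rewrite -(@powR_rate 1) ?powRr1 ?ltW//; by rewrite divff// gt_eqF.
Qed.

End scales.
End rates.

(** * The stopping time *)

Section stopping.
Variables (R : realType) (n : nat) (lam alpha : nat -> R).
Hypotheses (n0 : (0 < n)%N) (lam0 : forall i : 'I_n, 0 <= lam i).
Hypotheses (alpha0 : forall t, 0 <= alpha t) (alpha1 : forall t, alpha t <= 1).

Definition eff_dim (eta : R) : R := \sum_(i < n) Num.min 1 (eta * lam i).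

Lemma eff_dim_nondecreasing eta eta' : eta <= eta' -> eff_dim eta <= eff_dim eta'.
Proof.
move=> le; apply: ler_sum => i _; rewrite le_min ge_min lexx/= ge_min.
by rewrite ler_wpM2r ?lam0 ?orbT.
Qed.

Let etat := total_step alpha.

Lemma stop_criterion_total_step_gt0 t : stop_criterion n 1 alpha lam t -> 0 < etat t.
Proof.
rewrite /stop_criterion inver; have := total_step_ge0 alpha0 t.
rewrite le_eqVlt => /predU1P[<-|//].
by rewrite eqxx; rewrite ltNge leey.
Qed.

Lemma stop_criterionE t : 0 < etat t ->
  (stop_criterion n 1 alpha lam t <-> n%:R < etat t * Num.sqrt (eff_dim (etat t))).
Proof.
move=> e0; have nR : (0 : R) < n%:R by rewrite ltr0n.
rewrite /stop_criterion inver (gt_eqF e0) lte_fin -/(etat t) -/(eff_dim (etat t)) mul1r.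
set S := Num.sqrt _.
by rewrite [_^-1 * S]mulrC ltr_pdivlMr// mulrC ltr_pdivrMr// mulrC.
Qed.

Variables (E r q c : R).
Hypotheses (nE : n%:R = E * r) (E1 : 1 <= E) (r1 : 1 <= r) (q0 : 0 < q) (c0 : 0 < c).
Hypothesis eta_infty : total_step alpha t @[t --> \oo] --> +oo.
Hypothesis lower : forall eta, q * E <= eta -> r ^+ 2 / 8 <= eff_dim eta.
Hypothesis upper : eff_dim E <= c * r ^+ 2.

Let E0 : 0 < E. Proof. exact: lt_le_trans ltr01 E1. Qed.
Let r0 : 0 < r. Proof. exact: lt_le_trans ltr01 r1. Qed.

Let stop_if eta : 3 * E < eta -> q * E <= eta -> n%:R < eta * Num.sqrt (eff_dim eta).
Proof.
move=> h1 h2; have F8 := lower h2.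
have r3 : r / 3 <= Num.sqrt (eff_dim eta).
  rewrite -[leLHS]ger0_norm ?divr_ge0 ?(ltW r0)// -sqrtr_sqr ler_sqrt.
    by apply: le_trans F8; nra.
  by apply: le_trans F8; rewrite divr_ge0// exprn_ge0// ltW.
rewrite nE; apply: (@lt_le_trans _ _ (eta * (r / 3))).
  by rewrite mulrA ltr_pdivlMr// mulrAC ltr_pM2r// mulrC.
by rewrite ler_wpM2l//; apply/ltW/(lt_trans _ h1); rewrite mulr_gt0.
Qed.

(** Here [E] stands for n^(4m/(4m+1)).  By [lower] the criterion
    n < eta sqrt (N(eta)) holds once eta exceeds (q + 3) E, so just before the
    stopping time eta was smaller, and the last step adds at most 1 <= E.  By
    [upper] the criterion forces eta > E / sqrt c as long as eta <= E. *)
Lemma stopping_time_exists : exists T, [/\ is_stopping_time n 1 alpha lam T,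
  Num.min 1 (Num.sqrt c)^-1 * E <= total_step alpha T &
  total_step alpha T <= (q + 4) * E].
Proof.
have ex : exists t, `[< stop_criterion n 1 alpha lam t >].
  have /cvgryPge /(_ (Num.max (4 * E) (q * E))) [t0 _ /(_ t0 (leqnn t0))] := eta_infty.
  rewrite /= ge_max => /andP[h1 h2].
  have h3 : 3 * E < total_step alpha t0 by apply: lt_le_trans h1; rewrite ltr_pM2r// ltr_nat.
  exists t0; apply/asboolP; apply/stop_criterionE; last exact: stop_if.
  by apply: lt_trans h3; rewrite mulr_gt0.
case: (ex_minnP ex) => T /asboolP stopT minT; exists T.
have eT := stop_criterion_total_step_gt0 stopT.
split.
- by split => // t' /asboolP; exact: minT.
- have [ET|TE] := leP E (etat T).
    by apply: le_trans ET; rewrite ler_piMl ?(ltW E0)// ge_min lexx.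
  have /stop_criterionE := stopT; move=> /(_ eT) H.
  have sc : 0 < Num.sqrt c by rewrite sqrtr_gt0.
  have : n%:R < etat T * (Num.sqrt c * r).
    apply: (lt_le_trans H); rewrite ler_wpM2l ?(ltW eT)//.
    have -> : Num.sqrt c * r = Num.sqrt (c * r ^+ 2).
      by rewrite sqrtrM ?(ltW c0)// sqrtr_sqr ger0_norm ?(ltW r0).
    rewrite ler_wsqrtr//; apply: le_trans upper; apply: eff_dim_nondecreasing; exact: ltW.
  rewrite nE mulrA ltr_pM2r// => h.
  apply: (@le_trans _ _ ((Num.sqrt c)^-1 * E)).
    by rewrite ler_wpM2r ?(ltW E0)// ge_min lexx orbT.
  by rewrite ler_pdivrMl// mulrC ltW.
- case: T => [|T] in stopT minT eT *.
    by move: eT; rewrite /etat /total_step big_nil ltxx.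
  rewrite /total_step big_nat_recr//= -/(total_step alpha T) -/(etat T).
  have : etat T <= (q + 3) * E.
    rewrite leNgt; apply/negP => h.
    have h3 : 3 * E < etat T.
      by apply: le_lt_trans h; rewrite ler_pM2r// lerDr (ltW q0).
    have h4 : q * E <= etat T.
      by apply/ltW; apply: le_lt_trans h; rewrite ler_pM2r// lerDl.
    have : (T.+1 <= T)%N.
      apply: minT; apply/asboolP/stop_criterionE; last exact: stop_if.
      by apply: lt_trans h3; rewrite mulr_gt0.
    by rewrite ltnn.
  by move=> h; have := alpha1 T; have := E1; rewrite !mulrDl in h *; lra.
Qed.

End stopping.

(** The exponent is at least r^3 / (32 b^2), which exceeds 4 r^2 once
    r >= 128 b^2, while the prefactor 2 s^2 <= 2 r^4 is below exp (3 r^2). *)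
Lemma gram_failure_small (R : realType) (b r N s : R) : 1 <= r -> 0 < b ->
  128 * b ^+ 2 <= r -> 0 < s -> s <= r ^+ 2 -> r ^+ 7 <= N ->
  2 * s ^+ 2 * expR (- (N / (32 * s ^+ 2 * b ^+ 2))) <= expR (- r ^+ 2).
Proof.
move=> r1 b0 br s0 sr rN; have r0 : 0 < r by exact: lt_le_trans ltr01 r1.
have r2 : 0 <= r ^+ 2 by rewrite exprn_ge0// ltW.
have h1 : 4 * r ^+ 2 <= N / (32 * s ^+ 2 * b ^+ 2).
  rewrite ler_pdivlMr ?mulr_gt0 ?exprn_gt0//.
  apply: le_trans rN; have s4 : s ^+ 2 <= r ^+ 4.
    by rewrite (exprM r 2 2) lerXn2r// nnegrE// ltW.
  apply: (@le_trans _ _ (128 * b ^+ 2 * r ^+ 2 * r ^+ 4)).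
    have p : 0 <= 128 * b ^+ 2 * r ^+ 2 by rewrite mulr_ge0// mulr_ge0// sqr_ge0.
    apply: le_trans (ler_wpM2l p s4); rewrite le_eqVlt; apply/orP; left; apply/eqP; ring.
  have -> : r ^+ 7 = r * r ^+ 2 * r ^+ 4 by ring.
  have r4 : 0 <= r ^+ 4 by rewrite exprn_ge0// ltW.
  by apply: ler_wpM2r => //; apply: ler_wpM2r.
have h2 : 2 * s ^+ 2 <= expR (3 * r ^+ 2).
  have e1 := expR_ge1Dx (3 / 2 * r ^+ 2).
  have -> : 3 * r ^+ 2 = 3 / 2 * r ^+ 2 + 3 / 2 * r ^+ 2 by field.
  rewrite expRD; move: e1; set e := expR _.
  have : s ^+ 2 <= (r ^+ 2) ^+ 2 by rewrite lerXn2r// nnegrE// ltW.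
  move: r2; move: (r ^+ 2) (s ^+ 2) => x y x0 yx ex.
  have : (1 + 3 / 2 * x) ^+ 2 <= e * e.
    by rewrite -expr2 lerXn2r// nnegrE; lra.
  by nra.
apply: (@le_trans _ _ (expR (3 * r ^+ 2) * expR (- (4 * r ^+ 2)))).
  apply: ler_pM; rewrite ?expR_ge0//; first by rewrite mulr_ge0// exprn_ge0// ltW.
  by rewrite ler_expR lerN2.
by rewrite -expRD ler_expR; lra.
Qed.

(** * Effective dimension and power at the stopping time *)

Section effective_dimension_rates.
Variables (R : realType) (m : R) (n : nat).
Hypotheses (hm : 3 / 2 < m) (n0 : (0 < n)%N).
Let r := rate m n.
Let E := r `^ (4 * m).

Let r1 : 1 <= r. Proof. exact: rate_ge1. Qed.
Let r0 : 0 < r. Proof. exact: lt_le_trans ltr01 r1. Qed.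
Let r21 : 1 <= r ^+ 2. Proof. by rewrite exprn_ege1. Qed.

Lemma rate_ge (y : R) : 0 <= y -> y `^ (4 * m + 1) <= n%:R -> y <= r.
Proof.
move=> y0 yn; have m1 : 0 < 4 * m + 1 by move: hm; lra.
rewrite -[leLHS]powRr1// -[X in _ `^ X](@divff _ (4 * m + 1)) ?gt_eqF// powRrM.
by apply: ge0_ler_powR; rewrite ?invr_ge0 ?nnegrE ?powR_ge0// ltW.
Qed.

(** This is where m > 3/2 enters the probability of the good event: the sample
    size rate^(4m+1) is at least rate^7. *)
Lemma rate_exp7 : r ^+ 7 <= n%:R.
Proof.
rewrite [leRHS](rate_powR1 hm n0) -/r exprSr ler_wpM2r ?(ltW r0)//.
by rewrite -powR_mulrn ?(ltW r0)// ler_powR//; move: hm; lra.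
Qed.

Lemma rate_powR_ge1 : 1 <= E.
Proof. by have := ler_powR r1 (_ : 0 <= 4 * m); rewrite powRr0; apply; move: hm; lra. Qed.

Lemma rate_powR_sqr (p : R) : (r ^+ 2) `^ p = r `^ (2 * p).
Proof. by rewrite powRrM powR_mulrn ?(ltW r0). Qed.

Variables (lam : nat -> R) (b : nat -> 'I_n -> R) (mu : nat -> R) (am bm c : R).
Hypotheses (lam0 : forall i : 'I_n, 0 <= lam i) (mu0 : forall j, 0 <= mu j)
  (mudec : forall j, mu j.+1 <= mu j).
Hypotheses (am0 : 0 < am) (bm0 : 0 < bm).
Hypothesis decay : forall i : nat,
  am * i.+1%:R `^ (- (2 * m)) <= mu i <= bm * i.+1%:R `^ (- (2 * m)).
Hypothesis expansion : forall i i' : 'I_n,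
  series (fun j => mu j * b j i * b j i') k @[k --> \oo] --> (i == i')%:R * lam i.

(** [sum_min_le] with s of order r^2, the index at which the eigenvalue tail
    multiplied by eta is of order s. *)
Lemma eff_dim_upper (be : R) : 0 < be -> (forall j, \sum_i b j i ^+ 2 <= c) ->
  eff_dim n lam (be * E) <= 2 * (2 + be * c * bm) * r ^+ 2.
Proof.
move=> be0 bc; have E0 : 0 < E by exact: powR_gt0.
have [t0 t1 t2] := half_le_truncn r21.
pose s := (Num.truncn (r ^+ 2)).+1.
have sr : s%:R <= 2 * r ^+ 2 by rewrite /s -natr1; move: t1 r21; lra.
have rs : r ^+ 2 <= s%:R.
  by have /andP[_ /ltW] := truncn_itv (le_trans ler01 r21).
have c0 : 0 <= c by apply: le_trans (bc 0%N); apply: sumr_ge0 => i _; exact: sqr_ge0.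
have tail k : \sum_(s <= j < k) mu j <= bm * s%:R `^ (1 - 2 * m).
  apply: poly_decay_tail => //; first by move: hm; lra.
  by move=> i; have /andP[] := decay i.
have h := sum_min_le (eta := be * E) (lam := fun i : 'I_n => lam i) lam0 mu0 expansion
   (mulr_gt0 be0 E0) bc tail.
apply: (le_trans h).
have -> : 2 * (2 + be * c * bm) * r ^+ 2 = 2 * (2 * r ^+ 2 + be * c * bm * r ^+ 2) by ring.
rewrite ler_wpM2l//; apply: lerD => //.
have st : s%:R `^ (1 - 2 * m) <= r `^ (2 - 4 * m).
  have -> : 2 - 4 * m = 2 * (1 - 2 * m) by ring.
  rewrite -rate_powR_sqr (_ : 1 - 2 * m = - (2 * m - 1)); last by ring.
  rewrite !powRN lef_pV2 ?posrE ?powR_gt0 ?exprn_gt0//; apply: ge0_ler_powR => //.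
  - by move: hm; lra.
  - by rewrite nnegrE exprn_ge0// ltW.
  - by rewrite nnegrE.
have Er : E * r `^ (2 - 4 * m) = r ^+ 2.
  rewrite /E -powRD; last by apply/implyP => _; rewrite gt_eqF.
  by rewrite (_ : 4 * m + _ = 2%:R) ?powR_mulrn ?(ltW r0)//; ring.
rewrite -Er.
have -> : be * E * c * (bm * s%:R `^ (1 - 2 * m)) = (be * c * bm * E) * s%:R `^ (1 - 2 * m) by ring.
have k0 : 0 <= be * c * bm * E.
  by rewrite mulr_ge0 ?(ltW E0)// mulr_ge0 ?(ltW bm0)// mulr_ge0 ?(ltW be0).
by rewrite mulrA; apply: ler_wpM2l.
Qed.

(** [sum_min_ge] with s the integer part of r^2: the s-th eigenvalue is at
    least am / r^(4m). *)
Lemma eff_dim_lower eta :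
  let s := Num.truncn (r ^+ 2) in
  (forall j k, (j < s)%N -> (k < s)%N ->
    `|\sum_i b j i * b k i - (j == k)%:R| <= (2 * s%:R)^-1) ->
  am^-1 * E <= eta -> r ^+ 2 / 8 <= eff_dim n lam eta.
Proof.
move=> s gram etaE; have E0 : 0 < E by exact: powR_gt0.
have [s0 sr rs] := half_le_truncn r21; rewrite -/s in s0 sr rs.
have sR : (0 : R) < s%:R by rewrite ltr0n.
have h : 1 <= eta * mu s.-1.
  apply: (@le_trans _ _ ((am^-1 * E) * (am * s%:R `^ (- (2 * m))))).
    rewrite mulrACA mulVf ?gt_eqF// mul1r powRN -ler_pdivrMr ?invr_gt0 ?powR_gt0// invrK mul1r.
    rewrite (_ : E = (r ^+ 2) `^ (2 * m)).
      apply: ge0_ler_powR => //; first by move: hm; lra.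
      - by rewrite nnegrE ltW.
      - by rewrite nnegrE exprn_ge0// ltW.
    by rewrite rate_powR_sqr /E; congr (_ `^ _); ring.
  have /andP[+ _] := decay s.-1; rewrite prednK// => h.
  apply: ler_pM => //; first by rewrite mulr_ge0 ?invr_ge0// ltW.
  by rewrite mulr_ge0 ?powR_ge0// ltW.
have := sum_min_ge (lam := fun i : 'I_n => lam i) mu0 expansion s0 mudec h gram.
by apply: le_trans; move: rs; lra.
Qed.

End effective_dimension_rates.

Section type_two_error.
Context (R : realType) dO (Omega : measurableType dO) (P : probability Omega R).
Variable eps : nat -> {mfun Omega >-> R}.
Hypothesis eps_iid : iid P eps (normal_prob 0 1).
Variables (n : nat) (K U : 'M[R]_n) (lam alpha : nat -> R) (z : R) (t : nat) (v : 'cV[R]_n).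
Hypotheses (n0 : (0 < n)%N) (KU : eigendecomposition K U lam).

Lemma measurable_test :
  measurable [set e : n.-tuple R | test alpha lam K z t (v + \col_i tnth e i)].
Proof.
rewrite (_ : [set e | _] = (fun e : n.-tuple R =>
  `|test_stat alpha K (v + \col_i tnth e i) t - null_mean n alpha lam t|) @^-1`
   `[z * null_sd n alpha lam t, +oo[).
  rewrite -[_ @^-1` _]setTI.
  have m : measurable_fun setT (fun e : n.-tuple R => test_stat alpha K (v + \col_i tnth e i) t).
    under eq_fun do rewrite (test_statE alpha KU).
    apply: measurable_funM => //; apply: measurable_sum => i.
    apply: measurable_funM => //; apply: measurable_funX.
    under eq_fun do rewrite mxE.
    apply: measurable_sum => j; apply: measurable_funM => //.
    under eq_fun do rewrite !mxE.
    by apply: measurable_funD => //; exact: measurable_tnth.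
  have m' : measurable_fun setT (fun e : n.-tuple R =>
      `|test_stat alpha K (v + \col_i tnth e i) t - null_mean n alpha lam t|).
    by apply: (measurableT_comp (@normr_measurable R setT)); exact: measurable_funB.
  exact: m'.
by apply/seteqP; split => e /=; rewrite in_itv/= andbT.
Qed.

Let g (i : nat) := 1 - shrink lam alpha t i.

(** Without rejection |a + Z| <= kap r, where a = |G v|^2 is the signal energy
    and n times the null standard deviation is at most sqrt (2c) r; so
    |Z| >= a / 2, which [quadratic_chebyshev] bounds by e.  The constant in the
    lower bound on a gives, in this order, a >= r, a >= 2 kap r and the two
    halves of the bound e on (4 tr G^4 + 8 a) / (a / 2)^2. *)
Lemma type_two_error (c r e : R) (A : set Omega) :
  (forall i : 'I_n, 0 <= g i <= 1) -> \sum_(i < n) g i ^+ 4 <= c * r ^+ 2 ->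
  1 <= r -> 0 < c -> 0 < e ->
  (1 + 2 * (`|z| * Num.sqrt (2 * c)) + 64 / e + 32 * c / e) * r
     <= \sum_(i < n) g i ^+ 2 * (U^T *m v) i 0 ^+ 2 ->
  measurable A ->
  (forall w, A w -> ~~ test alpha lam K z t (v + \col_i eps i w)) ->
  (P A <= e%:E)%E.
Proof.
move=> g01 g4 r1 c0 e0 Abig mA notest.
have r0 : 0 < r by exact: lt_le_trans ltr01 r1.
have UU := eigen_orth KU.
set a := \sum_(i < n) _ in Abig.
set kap := `|z| * Num.sqrt (2 * c) in Abig.
have kap0 : 0 <= kap by rewrite mulr_ge0// sqrtr_ge0.
have nR : (0 : R) < n%:R by rewrite ltr0n.
pose B := orth_diag U (fun i => g i ^+ 2).
pose p i := 2 * (B *m v) i 0.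
have e1 : 0 < 64 / e by rewrite divr_gt0.
have e2 : 0 < 32 * c / e by rewrite divr_gt0// mulr_gt0.
have ar : a / 2 <= a - kap * r by move: Abig; nra.
have a0 : 0 < a by apply: lt_le_trans Abig; rewrite mulr_gt0//; lra.
have sdle : n%:R * null_sd n alpha lam t <= Num.sqrt (2 * c) * r.
  have hsq (x y : R) : 0 <= x -> x * Num.sqrt y = Num.sqrt (x ^+ 2 * y).
    by move=> x0; rewrite sqrtrM ?sqr_ge0// sqrtr_sqr ger0_norm.
  rewrite null_sdE [leRHS]mulrC !hsq ?(ltW nR) ?(ltW r0)//; apply: ler_wsqrtr.
  move: g4; rewrite /g; set S4 := \sum_(i < n) _ => g4.
  have -> : n%:R ^+ 2 * (2 / n%:R ^+ 2 * S4) = 2 * S4 by field; rewrite lt0r_neq0.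
  by rewrite [leRHS]mulrCA ler_wpM2l// mulrC.
have Bsum : \sum_i \sum_j B i j ^+ 2 = \sum_(i < n) g i ^+ 4.
  rewrite (orth_diag_entries_sqr UU); apply: eq_bigr => i _; by rewrite -exprM.
have psum : \sum_i p i ^+ 2 <= 4 * a.
  have -> : \sum_i p i ^+ 2 = 4 * \sum_i (B *m v) i 0 ^+ 2.
    by rewrite mulr_sumr; apply: eq_bigr => i _; rewrite /p; ring.
  rewrite ler_wpM2l// (orth_diag_mul_sqr UU); apply: ler_sum => i _.
  rewrite ler_wpM2r ?sqr_ge0//; have := g01 i; move: (g i) => x /andP[x0 x1].
  have := exprn_ge0 2 x0; have : x ^+ 2 <= 1 by rewrite expr_le1.
  move: (x ^+ 2) => y; nra.
have a2 : 0 < a / 2 by rewrite divr_gt0.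
have := @quadratic_chebyshev _ _ _ P eps eps_iid n B p (a / 2) A (orth_diag_sym _ _) mA a2 _.
move=> /(_ _)/le_trans; apply.
  move=> w /notest; rewrite /test -ltNge => h.
  have := test_stat_noise alpha KU v (\col_i eps i w) t n0; rewrite -/g -/a.
  set Q := (X in _ = _ + X); move=> E.
  have -> : \sum_i \sum_j B i j * (eps i w * eps j w - (i == j)%:R) + \sum_i p i * eps i w = Q.
    rewrite /Q; congr (_ + _).
      by apply: eq_bigr => i _; apply: eq_bigr => j _; rewrite !mxE.
    by apply: eq_bigr => i _; rewrite /p [(\col_i0 _) i 0]mxE.
  have : `|a + Q| <= kap * r.
    rewrite -E normrM (gtr0_norm nR); apply: (@le_trans _ _ (n%:R * (`|z| * null_sd n alpha lam t))).
      rewrite ler_wpM2l ?(ltW nR)//; apply/ltW/(lt_le_trans h).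
      by rewrite ler_wpM2r ?ler_norm// sqrtr_ge0.
    by rewrite mulrCA /kap -mulrA ler_wpM2l.
  rewrite ler_norml => /andP[_ h2]; apply: (le_trans ar).
  by rewrite ler_normr; apply/orP; right; lra.
rewrite lee_fin ler_pdivrMr ?exprn_gt0// Bsum.
apply: (@le_trans _ _ (4 * (c * r ^+ 2) + 2 * (4 * a))); first by lra.
have k1 : 64 / e * r <= a by apply: le_trans Abig; rewrite ler_wpM2r ?(ltW r0)//; lra.
have k2 : (32 * c / e) * r <= a by apply: le_trans Abig; rewrite ler_wpM2r ?(ltW r0)//; lra.
have k3 : r <= a by apply: le_trans Abig; rewrite ler_peMl ?(ltW r0)//; lra.
have k1' : 64 * r <= e * a by rewrite -ler_pdivrMl// mulrA [e^-1 * 64]mulrC.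
have k2' : 32 * c * r <= e * a by rewrite -ler_pdivrMl// mulrA [e^-1 * _]mulrC.
have q1 : 32 * c * r * r <= e * a * a.
  by apply: ler_pM => //; rewrite ?mulr_ge0 ?(ltW c0) ?(ltW r0).
have q2 : 64 * r * a <= e * a * a by rewrite ler_wpM2r ?(ltW a0).
have q3 : a <= r * a by rewrite ler_peMl ?(ltW a0).
have -> : e * (a / 2) ^+ 2 = e * a * a / 4 by field.
have -> : 4 * (c * r ^+ 2) = 32 * c * r * r / 8 by field.
lra.
Qed.

End type_two_error.

Lemma measurable_sample dO (Omega : measurableType dO) d (T : measurableType d)
  (X : nat -> {mfun Omega >-> T}) n : measurable_fun setT (sample X n).
Proof.
apply/measurable_fun_tnthP => i.
rewrite (_ : _ \o _ = X i); first exact: measurable_funPT.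
by apply/funext => w; rewrite /sample /= tnth_mktuple.
Qed.

Lemma step_sizes_le (R : realType) (alpha : nat -> R) (lam1 : R) t : 0 <= lam1 ->
  step_sizes alpha lam1 -> alpha t <= 1 /\ alpha t * lam1 <= 1.
Proof.
move=> l0 st; have := step_le st t; rewrite le_min lee_fin => /andP[a1].
rewrite inver; case: eqVneq => [->|l1]; first by rewrite mulr0.
by rewrite lee_fin -div1r ler_pdivlMr// lt_neqAle eq_sym l1.
Qed.

Section filter_bounds.
Variables (R : realType) (n : nat) (lam alpha : nat -> R) (t : nat).
Hypotheses (lam0 : forall i : 'I_n, 0 <= lam i) (alpha0 : forall t, 0 <= alpha t).
Hypothesis alam : forall t (i : 'I_n), alpha t * lam i <= 1.
Let eta := total_step alpha t.
Let S (i : nat) := shrink lam alpha t i.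

Let bnd (i : 'I_n) : [/\ 0 <= S i, S i <= 1, 1 - S i <= eta * lam i & S i * (1 + eta * lam i) <= 1].
Proof. exact: (shrink_bounds alpha0 t (lam0 i) (fun t => alam t i)). Qed.

Lemma filter_01 (i : 'I_n) : 0 <= 1 - S i <= 1.
Proof. by have [? ? _ _] := bnd i; apply/andP; split; lra. Qed.

Lemma filter_pow4_le : \sum_(i < n) (1 - S i) ^+ 4 <= eff_dim n lam eta.
Proof.
apply: ler_sum => i _; have /andP[x0 x1] := filter_01 i.
apply: (@le_trans _ _ (1 - S i)); first by rewrite exprS ler_piMr// exprn_ile1.
by rewrite le_min x1; have [] := bnd i.
Qed.

(** Each squared coordinate is at most twice the sum of its filtered part and of
    the part that gradient descent has not yet fitted; the latter is bounded by
    [rkhs_bias], since lam_i S_i^2 <= 1 / eta by [shrink_bounds]. *)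
Lemma filtered_energy_ge (T : Type) (D : set T) (H : set (T -> R)) ip K
    (x : n.-tuple T) (U : 'M[R]_n) f :
  is_rkhs D H ip K -> eigendecomposition (kernel_mx K x) U lam -> (0 < n)%N ->
  0 < eta -> H f ->
  (\sum_i eval_at f x i 0 ^+ 2) / 2 - n%:R * ip f f / eta
    <= \sum_(i < n) (1 - S i) ^+ 2 * (U^T *m eval_at f x) i 0 ^+ 2.
Proof.
move=> HK KU n0 eta0 Hf; have UU := eigen_orth KU.
have bias : \sum_(i < n) S i ^+ 2 * (U^T *m eval_at f x) i 0 ^+ 2 <= n%:R * ip f f / eta.
  apply: (rkhs_bias HK KU n0 eta0 _ Hf) => i; have [S0 S1 _ S3] := bnd i.
  rewrite -div1r ler_pdivlMr//; move: (S i) S0 S1 S3 (lam0 i) => s S0 S1 S3 l0i.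
  have : 0 <= eta * lam i by rewrite mulr_ge0// ltW.
  have -> : lam i * s ^+ 2 * eta = (eta * lam i) * s * s by ring.
  by move: (eta * lam i) S3 => h S3 h0; nra.
have split2 : (\sum_i eval_at f x i 0 ^+ 2) / 2 <=
    \sum_(i < n) (1 - S i) ^+ 2 * (U^T *m eval_at f x) i 0 ^+ 2
  + \sum_(i < n) S i ^+ 2 * (U^T *m eval_at f x) i 0 ^+ 2.
  rewrite -(sum_sqr_orth_tr UU) mulr_suml -big_split/=; apply: ler_sum => i _.
  move: ((U^T *m eval_at f x) i 0) (S i) => q s.
  have := sqr_ge0 ((1 - 2 * s) * q); nra.
by rewrite lerBlDr; apply: (le_trans split2); rewrite lerD2l.
Qed.

End filter_bounds.

Lemma rkhs_norm_le (R : realType) (x C : R) : 0 <= x -> Num.sqrt x <= C -> x <= C ^+ 2.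
Proof.
move=> x0 xC; rewrite -(sqr_sqrtr x0) lerXn2r// nnegrE ?sqrtr_ge0//.
exact: le_trans (sqrtr_ge0 _) xC.
Qed.

(** The square of the separation rate is rate^(-4m), and n = rate^(4m) rate. *)
Lemma separated_energy_ge (R : realType) (m : R) (n : nat) (v : 'cV[R]_n) (Ce : R) :
  (0 < n)%N -> 3 / 2 < m -> 0 <= Ce ->
  Ce * n%:R `^ (- (2 * m / (4 * m + 1))) <= emp_norm v ->
  Ce ^+ 2 * rate m n <= \sum_i v i 0 ^+ 2.
Proof.
move=> n0 hm Ce0; pose r := rate m n; pose E0 := r `^ (4 * m).
have r0 : 0 < r by exact: lt_le_trans ltr01 (rate_ge1 hm n0).
have nR : (0 : R) < n%:R by rewrite ltr0n.
have -> : n%:R `^ (- (2 * m / (4 * m + 1))) = r `^ (- (2 * m)) by apply: powR_rate; rewrite mulNr.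
set p := r `^ _.
have p2 : p ^+ 2 * E0 = 1.
  rewrite /p -powR_mulrn ?powR_ge0// -powRrM /E0 -powRD.
    by rewrite (_ : _ + _ = 0) ?powRr0//; ring.
  by apply/implyP => _; rewrite gt_eqF.
have Q0 : 0 <= n%:R^-1 * \sum_i v i 0 ^+ 2.
  by rewrite mulr_ge0 ?invr_ge0 ?(ltW nR)//; apply: sumr_ge0 => i _; exact: sqr_ge0.
move=> h; have h2 : (Ce * p) ^+ 2 <= n%:R^-1 * \sum_i v i 0 ^+ 2.
  by rewrite -[leRHS](sqr_sqrtr Q0) lerXn2r// nnegrE ?sqrtr_ge0// mulr_ge0 ?powR_ge0.
have := ler_wpM2l (ltW nR) h2.
rewrite mulVKf ?lt0r_neq0//; apply: le_trans.
rewrite (rate_powR1 hm n0) -/r -/E0 exprMn.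
have -> : E0 * r * (Ce ^+ 2 * p ^+ 2) = Ce ^+ 2 * (p ^+ 2 * E0) * r by ring.
by rewrite p2 mulr1.
Qed.

(** * The minimax rate at the stopping time *)

Unset Implicit Arguments.
Set Strict Implicit.
Set Printing Implicit Defensive.

Theorem corollary3p4 (R : realType) (m : R) (hm : 3 / 2 < m) :
  exists2 cm : R, 0 < cm &
  forall
    (d : nat) (d_ge1 : (1 <= d)%N)
    (D : set (d.-tuple R)) (mD : measurable D)
    (PX : probability (d.-tuple R) R)
    (H : set (d.-tuple R -> R))
    (ip : (d.-tuple R -> R) -> (d.-tuple R -> R) -> R)
    (K : d.-tuple R -> d.-tuple R -> R)
    (mu : nat -> R) (phi : nat -> d.-tuple R -> R) (cK : R)
    (H_rkhs : is_rkhs D H ip K) (H_L2 : sub_L2 PX H)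
    (K_mercer : mercer PX H ip K mu phi)
    (cK_gt0 : 0 < cK) (phi_bounded : forall j x, D x -> `|phi j x| <= cK)
    (K_decay : poly_decay m mu)
    (dO : measure_display) (Omega : measurableType dO)
    (P : probability Omega R)
    (X : nat -> {mfun Omega >-> d.-tuple R})
    (eps : nat -> {mfun Omega >-> R})
    (X_in : forall i w, D (X i w))
    (X_iid : iid P X PX)
    (eps_iid : iid P eps (normal_prob 0 1))
    (X_eps_indep : forall n,
      independent_vectors P (sample X n) (sample eps n))
    (kappa : forall n, R.-pker (n.-tuple (d.-tuple R)) ~> (n.-tuple R))
    (kappa_cond : forall n,
      cond_distribution P (sample X n) (sample eps n) (kappa n))
    (C level z : R) (level_gt0 : 0 < level) (level_lt1 : level < 1)
    (z_percentile : normal_prob 0 1 `]-oo, z] = (1 - level / 2)%:E)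
    (U : forall n, n.-tuple (d.-tuple R) -> 'M[R]_n)
    (lam alpha : forall n, n.-tuple (d.-tuple R) -> nat -> R)
    (K_eigen : forall n (x : n.-tuple (d.-tuple R)),
      (forall i, D (tnth x i)) ->
      eigendecomposition (kernel_mx K x) (U n x) (lam n x))
    (alpha_steps : forall n (x : n.-tuple (d.-tuple R)),
      (0 < n)%N -> (forall i, D (tnth x i)) ->
      step_sizes (alpha n x) (lam n x 0%N)),
  exists c1 a b : R, [/\ 0 < c1, 0 < a, 0 < b &
  forall e : R, 0 < e ->
  exists (Ce : R) (Ne : nat), 0 < Ce /\
  forall n : nat, (Ne <= n)%N ->
  exists E : set Omega, [/\ measurable E,
    ((1 - expR (- (cm * n%:R `^ ((2 * m - 3) / (2 * m - 1))))
        - expR (- (c1 * n%:R `^ (2 / (4 * m + 1)))))%:E < P E)%E &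
    forall w, E w ->
    let x := sample X n w in
    exists T : nat, [/\ is_stopping_time n 1 (alpha n x) (lam n x) T,
      a * n%:R `^ (4 * m / (4 * m + 1)) <= total_step (alpha n x) T
        <= b * n%:R `^ (4 * m / (4 * m + 1)) &
      ((1 - e)%:E <= ereal_inf
        [set cond_power (kappa n)
               (test (alpha n x) (lam n x) (kernel_mx K x) z T) f x
         | f in [set f | [/\ H f, (Num.sqrt (ip f f) <= C)%R &
                 (Ce * n%:R `^ (- (2 * m / (4 * m + 1)))
                   <= emp_norm (eval_at f x))%R]]])%E]]].
Proof.
exists 1; first exact: ltr01.
move=> d d_ge1 D mD PX H ip K mu phi cK H_rkhs H_L2 K_mercer cK_gt0 phi_bounded K_decay.
move=> dO Omega P X eps X_in X_iid eps_iid X_eps_indep kappa kappa_cond C level z.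
move=> level_gt0 level_lt1 z_percentile U lam alpha K_eigen alpha_steps.
have [am [bm [am0 bm0 decay]]] := K_decay.
pose Cup be : R := 2 * (2 + be * cK ^+ 2 * bm).
have Cup0 be : 0 < be -> 0 < Cup be.
  move=> be0; rewrite mulr_gt0// ltr_wpDr// mulr_ge0 ?(ltW bm0)// mulr_ge0 ?(ltW be0)//.
  exact: sqr_ge0.
pose a : R := Num.min 1 (Num.sqrt (Cup 1))^-1; pose b : R := am^-1 + 4.
have a0 : 0 < a by rewrite lt_min ltr01 invr_gt0 sqrtr_gt0 Cup0.
have ia0 : 0 < am^-1 by rewrite invr_gt0.
have b0 : 0 < b by rewrite addr_gt0.
(* Cup be bounds the effective dimension, in units of r^2, at eta = be r^(4m);
   a and b are the constants of [stopping_time_exists] with q = 1 / am *)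
exists 1, a, b; split => // e e0.
pose C2 := Cup b; have C20 : 0 < C2 by exact: Cup0.
(* L is the signal-to-noise ratio that [type_two_error] asks for, and Ce^2 is
   twice L plus the bias *)
pose L : R := 1 + 2 * (`|z| * Num.sqrt (2 * C2)) + 64 / e + 32 * C2 / e.
have L0 : 0 < L.
  have p1 : 0 <= `|z| * Num.sqrt (2 * C2) by rewrite mulr_ge0// sqrtr_ge0.
  have p2 : 0 < 64 / e by rewrite divr_gt0.
  have p3 : 0 < 32 * C2 / e by rewrite divr_gt0// mulr_gt0.
  by rewrite /L; lra.
have LC0 : 0 < 2 * (L + C ^+ 2 / a).
  by rewrite mulr_gt0// ltr_wpDr// divr_ge0 ?sqr_ge0// ltW.
pose Ce := Num.sqrt (2 * (L + C ^+ 2 / a)).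
(* the threshold on r in [gram_failure_small] *)
pose y : R := 128 * (cK ^+ 2 + 1) ^+ 2.
have y0 : 0 <= y by rewrite mulr_ge0// sqr_ge0.
exists Ce, (Num.truncn (y `^ (4 * m + 1))).+1; split; first by rewrite sqrtr_gt0.
move=> n nN; have n0 : (0 < n)%N by exact: leq_trans nN.
have yn : y `^ (4 * m + 1) <= n%:R.
  have /andP[_ h] := truncn_itv (powR_ge0 y (4 * m + 1)).
  by apply/ltW/(lt_le_trans h); rewrite ler_nat.
pose r := rate m n; pose E0 := r `^ (4 * m).
have yr : y <= r by exact: (rate_ge hm y0 yn).
have r1 : 1 <= r by exact: (rate_ge1 hm n0).
have r0 : 0 < r by exact: lt_le_trans ltr01 r1.
have E01 : 1 <= E0 by exact: (rate_powR_ge1 hm n0).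
have E00 : 0 < E0 by exact: lt_le_trans ltr01 E01.
have nE : n%:R = E0 * r by exact: (rate_powR1 hm n0).
have nR : (0 : R) < n%:R by rewrite ltr0n.
have r21 : 1 <= r ^+ 2 by rewrite exprn_ege1.
have [s0 sr _] := half_le_truncn r21; set s := Num.truncn (r ^+ 2) in s0 sr.
have mphi j : measurable_fun setT (phi j) by exact: (H_L2 _ (mercer_in K_mercer j)).1.
have phic j x : `|phi j x| <= cK.
  have [Dx|nDx] := pselect (D x); first exact: phi_bounded.
  by rewrite (rkhs_supp H_rkhs (mercer_in K_mercer j) nDx) normr0 ltW.
have [E1 [mE1 PE1 gram]] := gram_concentration X_iid mphi phic (mercer_L2 K_mercer) n0 s0.
pose V : {mfun Omega >-> n.-tuple (d.-tuple R)} :=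
  HB.pack (sample X n) (isMeasurableFun.Build _ _ _ _ _ (@measurable_sample _ _ _ _ X n)).
pose W : {mfun Omega >-> n.-tuple R} :=
  HB.pack (sample eps n) (isMeasurableFun.Build _ _ _ _ _ (@measurable_sample _ _ _ _ eps n)).
have [N [mN N0 kN]] := @conditional_law_ae _ _ _ P _ _ n V W (kappa n) (X_eps_indep n) (kappa_cond n).
have mVN : measurable (V @^-1` N) by exact: measurable_funPTI.
(* good event: the Gram matrix is close to the identity and the conditional law
   of the noise is its law *)
exists (E1 `\` (V @^-1` N)); split; first exact: measurableD.
  have PE : (P E1 <= P (E1 `\` (V @^-1` N)))%E.
    rewrite -[leRHS]adde0 -N0; apply: le_trans (measureU2 _ _ mVN); last exact: measurableD.
    apply: le_measure; [by rewrite inE|rewrite inE; apply: measurableU => //; exact: measurableD|].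
    by move=> w E1w; have [?|?] := pselect ((V @^-1` N) w); [right|left].
  apply: lt_le_trans PE; apply: lt_le_trans PE1.
  rewrite -EFinB lte_fin.
  have sR : (0 : R) < s%:R by rewrite ltr0n.
  have b00 : 0 < cK ^+ 2 + 1 by rewrite ltr_wpDl// sqr_ge0.
  have := gram_failure_small r1 b00 yr sR sr (rate_exp7 hm n0).
  have -> : n%:R `^ (2 / (4 * m + 1)) = r ^+ 2.
    by rewrite (@powR_rate R m n _ _ erefl) powR_mulrn ?(ltW r0).
  rewrite !mul1r => h; apply: (@lt_le_trans _ _ (1 - expR (- r ^+ 2))).
    by rewrite ltrD2r ltrBlDr ltrDl expR_gt0.
  by rewrite lerD2l lerN2.
move=> w [E1w nNw] x.
have xi i : tnth x i = X i w by rewrite /x /sample tnth_mktuple.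
have xD i : D (tnth x i) by rewrite xi.
have KU := K_eigen n x xD.
have st := alpha_steps n x n0 xD.
set lx := lam n x in KU st *; set ax := alpha n x in st *.
have l0 (i : 'I_n) : 0 <= lx i by exact: (eigen_ge0 KU).
have l00 : 0 <= lx 0%N by exact: (eigen_ge0 KU).
have ax0 t : 0 <= ax t by exact: (step_ge0 st).
have ax1 t : ax t <= 1 by have [] := step_sizes_le t l00 st.
have axl t (i : 'I_n) : ax t * lx i <= 1.
  have [_] := step_sizes_le t l00 st; apply: le_trans.
  by rewrite ler_wpM2l// (eigen_decr KU).
pose bc := eigen_coord phi x (U n x).
have bexp : forall i i' : 'I_n,
    series (fun j => mu j * bc j i * bc j i') k @[k --> \oo] --> (i == i')%:R * lx i.
  by move=> i i'; exact: (eigen_coord_expansion (mercer_expansion K_mercer) KU).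
have mu0 := mercer_ge0 K_mercer.
have bcup j : \sum_i bc j i ^+ 2 <= cK ^+ 2.
  under eq_bigr do rewrite expr2.
  rewrite (eigen_coord_dot phi KU) ler_pdivrMl//.
  apply: (@le_trans _ _ (\sum_(i < n) cK ^+ 2)).
    by apply: ler_sum => i _; rewrite -expr2 -(real_normK (num_real (phi j _))) lerXn2r// nnegrE ltW.
  by rewrite sumr_const card_ord mulr_natl.
have up be : 0 < be -> eff_dim n lx (be * E0) <= Cup be * r ^+ 2.
  by move=> be0; exact: (eff_dim_upper hm n0 l0 mu0 bm0 decay bexp be0 bcup).
have low eta : am^-1 * E0 <= eta -> r ^+ 2 / 8 <= eff_dim n lx eta.
  apply: (eff_dim_lower hm n0 mu0 (mercer_decr K_mercer) am0 decay bexp) => j k js ks.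
  rewrite (eigen_coord_dot phi KU).
  under eq_bigr do rewrite xi.
  exact: gram.
have up1 : eff_dim n lx E0 <= Cup 1 * r ^+ 2 by rewrite -[E0]mul1r; exact: up.
have [T [stopT aT bT]] := stopping_time_exists n0 l0 ax0 ax1 nE E01 r1 ia0 (Cup0 _ ltr01)
   (step_total st) low up1.
exists T; split => //.
  have -> : n%:R `^ (4 * m / (4 * m + 1)) = E0 by rewrite (@powR_rate R m n _ _ erefl).
  by rewrite aT bT.
have eT0 : 0 < total_step ax T by apply: lt_le_trans aT; rewrite mulr_gt0.
apply: le_ereal_inf_tmp => _ [f [Hf fC fn] <-].
rewrite /cond_power; set v := eval_at f x.
have UU := eigen_orth KU.
set eta := total_step ax T in aT bT eT0.
pose g (i : nat) := 1 - shrink lx ax T i.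
have g01 (i : 'I_n) : 0 <= g i <= 1 by exact: (filter_01 T l0 ax0 axl i).
have g4 : \sum_(i < n) g i ^+ 4 <= C2 * r ^+ 2.
  apply: (le_trans (filter_pow4_le T l0 ax0 axl)).
  by apply: (le_trans _ (up _ b0)); exact: (eff_dim_nondecreasing l0 bT).
have ip0 : 0 <= ip f f by exact: (rkhs_ip_ge0 H_rkhs).
have Abig : L * r <= \sum_(i < n) g i ^+ 2 * ((U n x)^T *m v) i 0 ^+ 2.
  apply: le_trans (filtered_energy_ge l0 ax0 axl H_rkhs KU n0 eT0 Hf).
  have := separated_energy_ge n0 hm (sqrtr_ge0 _) fn.
  rewrite sqr_sqrtr ?(ltW LC0)// -/r -/v => vbig.
  have bias : n%:R * ip f f / eta <= C ^+ 2 / a * r.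
    rewrite ler_pdivrMr//; apply: (@le_trans _ _ (C ^+ 2 / a * r * (a * E0))).
      have -> : C ^+ 2 / a * r * (a * E0) = n%:R * C ^+ 2.
        by rewrite nE; field; rewrite lt0r_neq0.
      by rewrite ler_wpM2l ?(ltW nR)//; exact: rkhs_norm_le.
    have k0 : 0 <= C ^+ 2 / a * r by rewrite mulr_ge0 ?(ltW r0)// divr_ge0 ?sqr_ge0 ?(ltW a0).
    by apply: ler_wpM2l.
  rewrite lerBrDr; apply: (le_trans (lerD (lexx _) bias)); rewrite ler_pdivlMr//.
  by apply: le_trans vbig; rewrite -mulrDl [_ * 2]mulrC mulrA.
set tst := [set u : n.-tuple R | _].
have mB : measurable tst by exact: (measurable_test ax z T v KU).
have mWt : measurable (W @^-1` tst) by exact: measurable_funPTI.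
have -> : kappa n x tst = P (W @^-1` tst).
  by apply: kN => //; exact: nNw.
pose A := ~` (W @^-1` tst).
have mA : measurable A by exact: measurableC.
have PA : (P A <= e%:E)%E.
  apply: (@type_two_error _ _ _ P eps eps_iid n (kernel_mx K x) (U n x) lx ax z T v n0 KU C2 r e A g01 g4 r1 C20 e0 Abig mA).
  move=> w' nt; apply/negP => t1; apply: nt; rewrite /tst /=.
  rewrite (_ : \col_i tnth _ i = \col_i eps i w')//.
  by apply/colP => i; rewrite !mxE /sample tnth_mktuple.
have -> : P (W @^-1` tst) = (1 - P A)%E.
  by rewrite -probability_setC// setCK.
by rewrite EFinB; apply: leeB.
Qed.
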